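(* Let $T$ be a weak mixing measure preserving transformation of a probability space $(\mathcal{X}, \mathcal{S}, \mu)$ and let $\mathcal{C} \subseteq \mathcal{S}$. (i) If $H_\mu(\mathcal{C}) = 0$, then $T$ is uniformly weak mixing on $\mathcal{C}$, in the sense that $$\lim_{n \to \infty} \, \sup_{A, B \in \mathcal{C}} \frac{1}{n} \sum_{i=0}^{n-1} \left| \mu(A \cap T^{-i} B) - \mu(A)\mu(B) \right| = 0.$$ (ii) Suppose that $T$ is invertible and that $(\mathcal{X}, \mathcal{S}, \mu)$ is Lebesgue. If $H_\mu(\mathcal{C}) > 0$, then there exists a dense $G_\delta$ set $G \subset \Phi$ such that for each $\phi \in G$, $$\limsup_{n \to \infty} \, \sup_{C \in \mathcal{C}} \frac{1}{n} \sum_{i=0}^{n-1} \left| \mu(C \cap T_\phi^{-i} C) - \mu(C)^2 \right| > 0.$$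
   Context: A measure preserving transformation $T$ of $(\mathcal{X}, \mathcal{S}, \mu)$ is weak mixing if $\lim_{n\to\infty} \frac{1}{n}\sum_{i=0}^{n-1} |\mu(A \cap T^{-i} B) - \mu(A)\mu(B)| = 0$ for all $A, B \in \mathcal{S}$. A Lebesgue probability space is a probability space isomorphic (modulo null sets) to the unit interval $[0,1)$ with Lebesgue measure. $\Phi$ is the space of invertible measure preserving transformations of $(\mathcal{X}, \mathcal{S}, \mu)$, where transformations agreeing $\mu$-almost everywhere are identified, endowed with the weak topology: $\phi_r \to \phi$ if $\lim_{r\to\infty} \mu(\phi_r A \, \triangle \, \phi A) = 0$ for all $A \in \mathcal{S}$. For a measure preserving transformation $T$ and $\phi \in \Phi$, $T_\phi = \phi^{-1} \circ T \circ \phi$. Entropy of a family. For a finite measurable partition $\Pi$ of $\mathcal{X}$, $H_\mu(\Pi) = -\sum_{A \in \Pi} \mu(A) \log \mu(A)$, with logarithms base 2 (cells are assumed, without loss of generality, to have positive measure, i.e. null cells contribute 0). For measurable sets $C_1, \ldots, C_n$, the join $\vee_{i=1}^n C_i$ is the partition of $\mathcal{X}$ with cells $\tilde{C}_1 \cap \cdots \cap \tilde{C}_n$, where each $\tilde{C}_i \in \{C_i, C_i^c\}$. For an ordered sequence $\mathbb{S} = (C_1, C_2, \ldots)$ of sets $C_i \in \mathcal{C}$, let $H_\mu(\mathbb{S}) = \liminf_{n\to\infty} \frac{1}{n} H_\mu(\vee_{i=1}^n C_i)$. The entropy of the family $\mathcal{C} \subseteq \mathcal{S}$ is $H_\mu(\mathcal{C})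 = \sup H_\mu(\mathbb{S})$, where the supremum is over all ordered sequences $\mathbb{S}$ of sets in $\mathcal{C}$. *)

(* Defs.v *)
(* MathComp / MathComp-Analysis *)
From HB Require Import structures.
From mathcomp Require Import all_boot all_order all_algebra.
From mathcomp Require Import all_classical all_reals all_analysis.
From mathcomp Require Import borel_hierarchy.

Set Implicit Arguments.
Unset Strict Implicit.
Unset Printing Implicit Defensive.

Import Order.TTheory GRing.Theory Num.Theory.
Import numFieldNormedType.Exports.

Local Open Scope classical_set_scope.
Local Open Scope ring_scope.

Definition measure_preserving d (X : measurableType d) (R : realType)
    (mu : probability X R) (T : X -> X) : Prop :=
  measurable_fun setT T /\
  forall A, measurable A -> mu (T @^-1` A) = mu A.

Section mixing.
Context d (X : measurableType d) (R : realType) (mu : probability X R).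
Implicit Types (T : X -> X) (A B : set X) (F : set (set X)).

(* The junk value at n = 0 is 0. *)
Definition mixing_mean T A B (n : nat) : R :=
  n%:R^-1 * \sum_(i < n)
    `|fine (mu (A `&` iter i T @^-1` B)) - fine (mu A) * fine (mu B)|.

Definition weak_mixing T : Prop :=
  forall A B, measurable A -> measurable B ->
    mixing_mean T A B n @[n --> \oo] --> 0.

(* The supremum of the empty set is -oo; otherwise the value is in [0, 1]. *)
Definition sup_mixing_mean T F (n : nat) : \bar R :=
  ereal_sup [set (mixing_mean T A B n)%:E | A in F & B in F].

Definition sup_self_mixing_mean T F (n : nat) : \bar R :=
  ereal_sup [set (mixing_mean T C C n)%:E | C in F].

Definition uniformly_weak_mixing_on T F : Prop :=
  sup_mixing_mean T F n @[n --> \oo] --> 0%E.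

End mixing.

Section entropy.
Context d (X : measurableType d) (R : realType) (mu : probability X R).

Definition log2 (x : R) : R := ln x / ln 2.

(* P is meant to be a finite measurable partition, given by its set of cells;
   null cells contribute 0 * log2 0 = 0. *)
Definition partition_entropy (P : set (set X)) : R :=
  - \sum_(A \in P) fine (mu A) * log2 (fine (mu A)).

(* The cells of the join of C 0, ..., C n.-1; the empty set may be listed as a
   cell. *)
Definition set_join (C : nat -> set X) (n : nat) : set (set X) :=
  [set \bigcap_(i in `I_n) (if s i then C i else ~` C i)
     | s in [set: nat -> bool]].

Definition sequence_entropy (C : nat -> set X) : \bar R :=
  limn_einf (fun n => (n%:R^-1 * partition_entropy (set_join C n))%:E).

Definition family_entropy (F : set (set X)) : \bar R :=
  ereal_sup [set sequence_entropy C | C in [set C | forall i, F (C i)]].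

End entropy.

Section lebesgue_space.

(* mu and the restriction of nu to E are isomorphic modulo null sets; that the
   inverse g is measure preserving as well follows. *)
Definition isomorphic_mod0 d (X : measurableType d) d' (Y : measurableType d')
    (R : realType) (mu : {measure set X -> \bar R})
    (nu : {measure set Y -> \bar R}) (E : set Y) : Prop :=
  exists (X0 : set X) (Y0 : set Y) (f : X -> Y) (g : Y -> X),
    [/\ measurable X0 /\ mu (~` X0) = 0%E,
        [/\ measurable Y0, Y0 `<=` E & nu (E `\` Y0) = 0%E],
        [/\ set_fun X0 Y0 f, set_fun Y0 X0 g,
            {in X0, cancel f g} & {in Y0, cancel g f}],
        measurable_fun X0 f /\ measurable_fun Y0 g &
        forall B, measurable B -> B `<=` Y0 -> mu (X0 `&` f @^-1` B) = nu B].

(* [0, 1) may carry either its Borel or its Lebesgue sigma-algebra. *)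
Definition lebesgue_space d (X : measurableType d) (R : realType)
    (mu : probability X R) : Prop :=
  isomorphic_mod0 mu (@lebesgue_measure R) `[0, 1[%classic \/
  isomorphic_mod0 mu (@completed_lebesgue_measure R) `[0, 1[%classic.

End lebesgue_space.

Section automorphisms.
Context d (X : measurableType d) (R : realType) (mu : probability X R).

(* Everywhere-defined bijections; on a Lebesgue space every bijection modulo
   null sets agrees almost everywhere with one of these. That the inverse is
   measure preserving follows. *)
Record automorphism := Automorphism {
  aut_fun :> X -> X;
  aut_inv : X -> X;
  autK : cancel aut_fun aut_inv;
  aut_invK : cancel aut_inv aut_fun;
  aut_measure_preserving : measure_preserving mu aut_fun;
  measurable_aut_inv : measurable_fun setT aut_inv
}.

HB.instance Definition _ := gen_eqMixin automorphism.
HB.instance Definition _ := gen_choiceMixin automorphism.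

Definition aut_ae_eq (phi psi : automorphism) : bool :=
  `[< {ae mu, forall x, phi x = psi x} >].

Let aut_ae_eq_refl : reflexive aut_ae_eq.
Proof. by move=> phi; apply/asboolP; exact: aeW. Qed.

Let aut_ae_eq_sym : symmetric aut_ae_eq.
Proof.
by move=> phi psi; apply/idP/idP => /asboolP h; apply/asboolP;
  apply: filterS h.
Qed.

Let aut_ae_eq_trans : transitive aut_ae_eq.
Proof.
move=> psi phi chi /asboolP h1 /asboolP h2; apply/asboolP.
by apply: filterS2 h1 h2 => x -> ->.
Qed.

Canonical aut_ae_eq_equiv :=
  EquivRel aut_ae_eq aut_ae_eq_refl aut_ae_eq_sym aut_ae_eq_trans.

Local Open Scope quotient_scope.

Definition Phi : Type := {eq_quot aut_ae_eq}.
HB.instance Definition _ := Choice.on Phi.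
HB.instance Definition _ := EqQuotient.on Phi.

Definition aut_class (phi : automorphism) : Phi := \pi_Phi phi.

Lemma aut_classP (phi psi : automorphism) :
  aut_class phi = aut_class psi <-> {ae mu, forall x, phi x = psi x}.
Proof.
split=> [/eqP|h]; first by rewrite /aut_class eqmodE => /asboolP.
by apply/eqP; rewrite /aut_class eqmodE; apply/asboolP.
Qed.

(* The basic neighbourhoods of the class of phi are
   {psi | mu (psi A + phi A) < e for all A in F}, where F is a finite set of
   measurable sets, e > 0 and + is the symmetric difference. *)
Definition weak_open (U : set Phi) : Prop :=
  forall phi : automorphism, U (aut_class phi) ->
    exists F : set (set X), exists e : R,
      [/\ finite_set F, F `<=` measurable, 0 < e &
        forall psi : automorphism,
          (forall A, F A -> (mu ((psi @` A) `+` (phi @` A)) < e%:E)%E) ->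
          U (aut_class psi)].

Let weak_openT : weak_open setT.
Proof. by move=> phi _; exists set0, 1; split. Qed.

Let weak_openI (U V : set Phi) :
  weak_open U -> weak_open V -> weak_open (U `&` V).
Proof.
move=> oU oV phi [/oU[F [e [finF mF e0 FU]]] /oV[G [r [finG mG r0 GV]]]].
exists (F `|` G), (Num.min e r); split.
- by rewrite finite_setU.
- by move=> A [/mF|/mG].
- by rewrite lt_min e0 r0.
- move=> psi h; split; [apply: FU => A FA|apply: GV => A GA].
    by apply: (lt_le_trans (h A (or_introl FA))); rewrite lee_fin ge_min lexx.
  by apply: (lt_le_trans (h A (or_intror GA))); rewrite lee_fin ge_min lexx orbT.
Qed.

Let weak_open_bigcup (I : Type) (f : I -> set Phi) :
  (forall i, weak_open (f i)) -> weak_open (\bigcup_i f i).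
Proof.
move=> of_ phi [i _ /of_[F [e [finF mF e0 FU]]]].
by exists F, e; split=> // psi /FU ?; exists i.
Qed.

HB.instance Definition _ :=
  isOpenTopological.Build Phi weak_openT weak_openI weak_open_bigcup.

Lemma image_aut (phi : automorphism) (A : set X) :
  phi @` A = aut_inv phi @^-1` A.
Proof.
apply/seteqP; split=> [_ [x Ax <-]|x Ax] /=; first by rewrite autK.
by exists (aut_inv phi x) => //; exact: aut_invK.
Qed.

Lemma measurable_image_aut (phi : automorphism) (A : set X) :
  measurable A -> measurable (phi @` A).
Proof.
by move=> mA; rewrite image_aut -[_ @^-1` _]setTI; exact: measurable_aut_inv.
Qed.

Lemma measure_image_aut (phi : automorphism) (A : set X) :
  measurable A -> mu (phi @` A) = mu A.
Proof.
move=> mA; have [_ <-] := aut_measure_preserving phi.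
  congr (mu _); apply/seteqP; split=> [x [a Aa /(can_inj (autK phi)) <-]//|x Ax].
  by exists x.
exact: measurable_image_aut.
Qed.

Let setY_lt (A B : set X) (e : R) : 0 < e -> A = B -> (mu (A `+` B) < e%:E)%E.
Proof. by move=> e0 ->; rewrite setYK measure0 lte_fin. Qed.

Let measurable_setY (A B : set X) :
  measurable A -> measurable B -> measurable (A `+` B).
Proof.
by move=> mA mB; rewrite setY_def; apply: measurableU; apply: measurableD.
Qed.

Let measure_setY_triangle (A B C : set X) :
  measurable A -> measurable B -> measurable C ->
  (mu (A `+` C) <= mu (A `+` B) + mu (B `+` C))%E.
Proof.
move=> mA mB mC.
apply: (@le_trans _ _ (mu ((A `+` B) `|` (B `+` C)))).
  apply: le_measure; rewrite ?inE; [exact: measurable_setY| |].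
    by apply: measurableU; exact: measurable_setY.
  rewrite !setY_def => x /=.
  by have [Bx|Bx] := pselect (B x); tauto.
by apply: measureU2; exact: measurable_setY.
Qed.

Let ae_eq_image (phi psi : automorphism) (A : set X) : measurable A ->
  {ae mu, forall x, phi x = psi x} -> mu ((phi @` A) `+` (psi @` A)) = 0%E.
Proof.
move=> mA [M [mM M0 NM]]; apply/eqP; rewrite -measure_le0.
apply: (@le_trans _ _ (mu ((phi @` M) `|` (psi @` M)))).
  apply: le_measure; rewrite ?inE.
  - by apply: measurable_setY; exact: measurable_image_aut.
  - by apply: measurableU; exact: measurable_image_aut.
  - rewrite setY_def => x [[[a Aa <-] na]|[[a Aa <-] na]]; [left|right];
      by exists a => //; apply: NM => /= pa; apply: na; exists a.
have mpM := measurable_image_aut phi mM.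
have mqM := measurable_image_aut psi mM.
apply: (@le_trans _ _ (mu (phi @` M) + mu (psi @` M))%E).
  exact: measureU2.
by rewrite !measure_image_aut// M0 adde0.
Qed.

Let weak_ball (phi : automorphism) (A : set X) (e : R) : set Phi :=
  [set q | exists2 psi : automorphism, q = aut_class psi &
    (mu ((psi @` A) `+` (phi @` A)) < e%:E)%E].

Let weak_ballP (phi psi : automorphism) (A : set X) (e : R) : measurable A ->
  weak_ball phi A e (aut_class psi) <->
  (mu ((psi @` A) `+` (phi @` A)) < e%:E)%E.
Proof.
move=> mA; split=> [[chi /aut_classP pc ce]|]; last by exists psi.
apply: (le_lt_trans (measure_setY_triangle (B := chi @` A) _ _ _));
  do ?exact: measurable_image_aut.
by rewrite (ae_eq_image mA pc) add0e.
Qed.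

Let weak_ball_open (phi : automorphism) (A : set X) (e : R) : measurable A ->
  weak_open (weak_ball phi A e).
Proof.
move=> mA psi /(weak_ballP _ _ _ mA) pe.
have mY : measurable ((psi @` A) `+` (phi @` A)).
  by apply: measurable_setY; exact: measurable_image_aut.
have fm : mu ((psi @` A) `+` (phi @` A)) \is a fin_num.
  exact: fin_num_measure.
exists [set A], (e - fine (mu ((psi @` A) `+` (phi @` A)))); split.
- exact: finite_set1.
- by move=> _ ->.
- by rewrite subr_gt0 -lte_fin fineK.
- move=> chi /(_ A erefl) h; apply/(weak_ballP _ _ _ mA).
  apply: (le_lt_trans (measure_setY_triangle (B := psi @` A) _ _ _));
    do ?exact: measurable_image_aut.
  by rewrite -lteBrDr// EFinB fineK// in h *.
Qed.

Lemma weak_cvgP (u : nat -> automorphism) (phi : automorphism) :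
  aut_class (u n) @[n --> \oo] --> aut_class phi <->
  forall A, measurable A ->
    mu ((u n @` A) `+` (phi @` A)) @[n --> \oo] --> 0%E.
Proof.
split=> [h A mA|h].
- have fm n : mu ((u n @` A) `+` (phi @` A)) \is a fin_num.
    apply: fin_num_measure.
    by apply: measurable_setY; exact: measurable_image_aut.
  apply/fine_cvgP; split; first by apply: nearW.
  apply/cvgrPdist_lt => e e0.
  have : nbhs (aut_class phi) (weak_ball phi A e).
    apply: open_nbhs_nbhs; split; first exact: weak_ball_open.
    by apply/(weak_ballP _ _ _ mA); exact: setY_lt.
  move=> /h hn.
  have {hn} : \forall n \near \oo, weak_ball phi A e (aut_class (u n)) by [].
  apply: filterS => n /(weak_ballP _ _ _ mA) ne /=.
  by rewrite sub0r normrN ger0_norm ?fine_ge0// -lte_fin fineK.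
- move=> U; rewrite nbhsE => -[V [oV Vphi] VU].
  have [F [e [finF mF e0 FV]]] := oV phi Vphi.
  have : \forall n \near \oo, forall A, F A ->
      (mu ((u n @` A) `+` (phi @` A)) < e%:E)%E.
    have [K KF] := finite_fsetP.1 finF.
    have kF A : F A -> \forall n \near \oo,
        (mu ((u n @` A) `+` (phi @` A)) < e%:E)%E.
      move=> /mF mA; apply: (h A mA (fun x => (x < e%:E)%E)).
      by apply: open_ereal_lt'; rewrite lte_fin.
    rewrite {}KF in kF *.
    exact: (filter_bigI (F := \oo) _ kF).
  move=> hn; suff : \forall n \near \oo, U (aut_class (u n)) by [].
  by apply: filterS hn => n /FV; exact: VU.
Qed.

End automorphisms.

(* This includes maps that are bijective only modulo null sets. *)
Definition invertible d (X : measurableType d) (R : realType)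
    (mu : probability X R) (T : X -> X) : Prop :=
  exists S : automorphism mu, {ae mu, forall x, T x = S x}.

Definition conjugate d (X : measurableType d) (R : realType)
    (mu : probability X R) (T : X -> X) (phi : automorphism mu) : X -> X :=
  aut_inv phi \o T \o phi.

(* Main.v *)
(* The entropy of C is controlled by conditional quantities: for a finite
   measurable partition P, put D(P, C) = sum over A in P of
   min(mu(A & C), mu(A \ C)), the distance from C to the sets measurable with
   respect to P.  Since min(a, b) <= eta(a) + eta(b) - eta(a + b) <=
   e (a + b) + L_e min(a, b) for eta(x) = - x log2 x, refining P by C raises the
   entropy by at least D(P, C) and by at most e + L_e D(P, C).  Hence zero
   entropy gives, for every e, a P with D(P, C) < e for all C in the family,
   i.e. total boundedness in measure, and (i) follows because the mixing means
   are uniformly Lipschitz.  Positive entropy gives del > 0 such that every P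
   admits a C in the family with D(P, C) >= del.

   For (ii), the set of classes phi whose mixing mean exceeds del^2 / 2 for some
   C and some n >= N is open, and it remains to find, near any phi0, one phi
   lying in all of these sets.  Given P, choose C with D(P, C) >= del and Z
   consisting of two pieces of equal measure in each cell of P, one inside and
   one outside C.  Replacing the inner piece by Z & V or by Z \ V, where V is
   almost invariant and halves the cells of Z, gives two sets having the same
   measure as C in each cell; the correlations of the indicator of V with itself
   persist up to time n, so one of the two sets has mixing mean > del^2 / 2.  A
   swap along the orbits, preserving the cells of P, carries C to that set.
   Iterating with partitions that fix all previously chosen sets and also the
   dyadic sets in the coordinate of the Lebesgue space and in its image yields a
   sequence converging in the weak topology to an automorphism. *)

Require Import Defs.
From HB Require Import structures.
From mathcomp Require Import all_boot all_order all_algebra.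
From mathcomp Require Import all_classical all_reals all_analysis.
From mathcomp Require Import borel_hierarchy.
From mathcomp Require Import measurable_realfun.
From mathcomp Require Import lra ring zify.

Import Order.TTheory GRing.Theory Num.Theory.
Import numFieldNormedType.Exports.

Set Implicit Arguments.
Unset Strict Implicit.
Unset Printing Implicit Defensive.

Local Open Scope classical_set_scope.
Local Open Scope ring_scope.

(** * Real-valued probabilities *)

Section prob.
Context d (X : measurableType d) (R : realType) (mu : probability X R).
Implicit Types (A B C D : set X) (T : X -> X).

Definition pr A : R := fine (mu A).

Lemma prE A : measurable A -> mu A = (pr A)%:E.
Proof. by move=> mA; rewrite /pr fineK// fin_num_measure. Qed.

Lemma pr_ge0 A : 0 <= pr A.
Proof. by rewrite /pr fine_ge0. Qed.

Lemma pr_set0 : pr set0 = 0.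
Proof. by rewrite /pr measure0. Qed.

Lemma pr_setT : pr setT = 1.
Proof. by rewrite /pr probability_setT. Qed.

Lemma pr_le A B : measurable A -> measurable B -> A `<=` B -> pr A <= pr B.
Proof.
by move=> mA mB AB; rewrite -lee_fin -!prE// le_measure// inE.
Qed.

Lemma prU A B : measurable A -> measurable B -> A `&` B = set0 ->
  pr (A `|` B) = pr A + pr B.
Proof.
move=> mA mB AB; have mAB := measurableU _ _ mA mB.
by apply: EFin_inj; rewrite EFinD -!prE// measureU.
Qed.

Lemma pr_split A B : measurable A -> measurable B ->
  pr A = pr (A `&` B) + pr (A `\` B).
Proof.
move=> mA mB; rewrite -prU ?setUIDK//; [exact: measurableI|exact: measurableD|].
by apply/seteqP; split => x //= -[[_ ?] [_ ?]].
Qed.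

Lemma pr_setC A : measurable A -> pr (~` A) = 1 - pr A.
Proof.
by move=> mA; rewrite -pr_setT (pr_split measurableT mA) setTI setTD; lra.
Qed.

Lemma pr_le1 A : measurable A -> pr A <= 1.
Proof. by move=> mA; rewrite -pr_setT pr_le. Qed.

Lemma prU_le A B : measurable A -> measurable B ->
  pr (A `|` B) <= pr A + pr B.
Proof.
move=> mA mB; have mAB := measurableU _ _ mA mB.
rewrite (pr_split mAB mB) addrC lerD//; apply: pr_le => //.
- exact: measurableD.
- by move=> x [[]].
- exact: measurableI.
Qed.

Lemma measurableY A B : measurable A -> measurable B -> measurable (A `+` B).
Proof.
by move=> mA mB; rewrite setY_def; apply: measurableU; apply: measurableD.
Qed.

Lemma prY A B : measurable A -> measurable B ->
  pr (A `+` B) = pr (A `\` B) + pr (B `\` A).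
Proof.
move=> mA mB; rewrite setY_def prU//; try exact: measurableD.
by apply/seteqP; split => x //= -[[? ?] [? ?]].
Qed.

Lemma prY_triangle B A C :
  measurable A -> measurable B -> measurable C ->
  pr (A `+` C) <= pr (A `+` B) + pr (B `+` C).
Proof.
move=> mA mB mC; apply: le_trans (prU_le _ _); try exact: measurableY.
apply: pr_le; [exact: measurableY| |].
  by apply: measurableU; exact: measurableY.
rewrite !setY_def => x /=.
by have [Bx|Bx] := pselect (B x); tauto.
Qed.

Lemma pr_dist A B : measurable A -> measurable B ->
  `|pr A - pr B| <= pr (A `+` B).
Proof.
move=> mA mB; rewrite prY// (pr_split mA mB) (pr_split mB mA) setIC.
have := pr_ge0 (A `\` B); have := pr_ge0 (B `\` A).
by move=> h1 h2; rewrite ler_norml; apply/andP; split; lra.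
Qed.

Lemma prY0_eq A B : measurable A -> measurable B -> pr (A `+` B) = 0 ->
  pr A = pr B.
Proof.
move=> mA mB h; have := pr_dist mA mB.
by rewrite h normr_le0 subr_eq0 => /eqP.
Qed.

Lemma prYI A A' B B' :
  measurable A -> measurable A' -> measurable B -> measurable B' ->
  pr ((A `&` B) `+` (A' `&` B')) <= pr (A `+` A') + pr (B `+` B').
Proof.
move=> mA mA' mB mB'; apply: le_trans (prU_le _ _); try exact: measurableY.
apply: pr_le.
- by apply: measurableY; exact: measurableI.
- by apply: measurableU; exact: measurableY.
- rewrite !setY_def => x /= [] [] [? ?] /not_andP [] ?; tauto.
Qed.

Lemma pr_preimage T A : measure_preserving mu T -> measurable A ->
  pr (T @^-1` A) = pr A.
Proof. by move=> [_ h] mA; rewrite /pr h. Qed.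

Lemma measurable_preimage T A : measure_preserving mu T -> measurable A ->
  measurable (T @^-1` A).
Proof. by move=> [h _] mA; rewrite -[_ @^-1` _]setTI; exact: h. Qed.

Lemma mp_comp T1 T2 : measure_preserving mu T1 -> measure_preserving mu T2 ->
  measure_preserving mu (T1 \o T2).
Proof.
move=> h1 h2; split.
  by apply: measurableT_comp; [exact: h1.1|exact: h2.1].
move=> A mA; rewrite comp_preimage h2.2 ?h1.2//.
exact: measurable_preimage.
Qed.

Lemma mp_id : measure_preserving mu (@idfun X).
Proof. by split => //; exact: measurable_id. Qed.

Lemma mp_iter T n : measure_preserving mu T -> measure_preserving mu (iter n T).
Proof.
move=> h; elim: n => [|n ih]; first exact: mp_id.
have -> : iter n.+1 T = T \o iter n T by [].
exact: mp_comp.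
Qed.

Lemma mixing_meanE T A B n : mixing_mean mu T A B n =
  n%:R^-1 * \sum_(i < n) `|pr (A `&` iter i T @^-1` B) - pr A * pr B|.
Proof. by []. Qed.

Lemma mixing_mean_ge0 T A B n : 0 <= mixing_mean mu T A B n.
Proof.
by rewrite /mixing_mean mulr_ge0 ?invr_ge0// sumr_ge0.
Qed.

(** At [n = 0] both means are 0, and the bound then rests on [0 <= c]. *)
Lemma mean_le n (f g : 'I_n -> R) (c : R) : 0 <= c ->
  (forall i, f i <= g i + c) ->
  n%:R^-1 * \sum_(i < n) f i <= n%:R^-1 * (\sum_(i < n) g i) + c.
Proof.
move=> c0 h; case: n f g h => [|n] f g h; first by rewrite !big_ord0 mulr0 add0r.
have n0 : 0 < (n.+1%:R : R) by rewrite ltr0n.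
rewrite -[leRHS](mulKf (lt0r_neq0 n0)) ler_pM2l ?invr_gt0//.
rewrite mulrDr mulVKf ?lt0r_neq0//.
apply: le_trans (ler_sum _ (fun i _ => h i)) _.
by rewrite big_split/= sumr_const card_ord mulr_natl.
Qed.

(** In each summand, the measure of the intersection and the product of measures both move by at
    most the total symmetric difference, hence the factor 2. Invariance of [mu] makes the bound
    independent of [i] and [n]. *)
Lemma mixing_mean_lip T A B A' B' n : measure_preserving mu T ->
  measurable A -> measurable A' -> measurable B -> measurable B' ->
  mixing_mean mu T A B n <= mixing_mean mu T A' B' n +
    2 * (pr (A `+` A') + pr (B `+` B')).
Proof.
move=> mpT mA mA' mB mB'; rewrite !mixing_meanE; apply: mean_le.
  by rewrite mulr_ge0// addr_ge0// pr_ge0.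
move=> i; have mpi := mp_iter i mpT.
have mB1 := measurable_preimage mpi mB.
have mB1' := measurable_preimage mpi mB'.
set P := iter i T @^-1` B; set P' := iter i T @^-1` B'.
have h1 : `|pr (A `&` P) - pr (A' `&` P')| <= pr (A `+` A') + pr (B `+` B').
  apply: le_trans (pr_dist _ _) _; try exact: measurableI.
  apply: le_trans (prYI _ _ _ _) _ => //; rewrite lerD2l.
  by rewrite -(pr_preimage mpi (measurableY mB mB')).
have h2 : `|pr A * pr B - pr A' * pr B'| <= pr (A `+` A') + pr (B `+` B').
  have -> : pr A * pr B - pr A' * pr B' =
    (pr A - pr A') * pr B + pr A' * (pr B - pr B') by ring.
  apply: le_trans (ler_normD _ _) _; rewrite !normrM.
  rewrite (ger0_norm (pr_ge0 B)) (ger0_norm (pr_ge0 A')) lerD//.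
    by apply: le_trans (pr_dist mA mA'); rewrite ler_piMr// pr_le1.
  by apply: le_trans (pr_dist mB mB'); rewrite ler_piMl// pr_le1.
move: h1 h2; move: (pr (A `+` A') + pr (B `+` B')) => e.
move: (pr (_ `&` P)) (pr (_ `&` P')) (pr A * _) (pr A' * _) => a b c c' h h'.
have -> : a - c = (a - b) + (b - c') + (c' - c) by ring.
apply: le_trans (ler_normD _ _) _; rewrite (distrC c').
by have := ler_normD (a - b) (b - c'); lra.
Qed.

(** * Fibers of finite-valued maps *)

Section fibers.
Variables (I : finType) (kap : X -> I).
Hypothesis mk : forall i, measurable (kap @^-1` [set i]).

Lemma measurable_fiber_pred (P : pred I) : measurable [set x | P (kap x)].
Proof.
rewrite (_ : [set _ | _] = \big[setU/set0]_(i | P i) (kap @^-1` [set i])).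
  by apply: bigsetU_measurable.
rewrite -bigcup_seq_cond/=; apply/seteqP; split => x.
  by move=> Px; exists (kap x) => //=; rewrite mem_index_enum.
by case=> i /= /andP[_ Pi] kx; rewrite kx.
Qed.

Lemma pr_fibers A : measurable A ->
  pr A = \sum_i pr (A `&` kap @^-1` [set i]).
Proof.
move=> mA; apply: (@EFin_inj R); rewrite -prE// -sumEFin.
have {1}-> : A = \bigcup_(i in [set: I]) (A `&` kap @^-1` [set i]).
  by apply/seteqP; split => x; [move=> Ax; exists (kap x)|move=> [i _ []]].
rewrite measure_fin_bigcup//; last 2 first.
- by move=> i j _ _ [x [[_ <-] [_ <-]]].
- by move=> i _; exact: measurableI.
rewrite (fsbigE (index_enum I))/= ?index_enum_uniq//; last first.
  by move=> i _; rewrite mem_index_enum.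
apply: eq_big => [i|i _]; first by rewrite in_setT.
- by rewrite prE//; exact: measurableI.
- exact: finite_finset.
Qed.

End fibers.

Lemma pr_nonincreasing (F : nat -> set X) (e : R) : 0 < e ->
  (forall n, measurable (F n)) -> (forall n, F n.+1 `<=` F n) ->
  pr (\bigcap_n F n) = 0 -> exists n, pr (F n) < e.
Proof.
move=> e0 mF dF F0.
have mcap : measurable (\bigcap_n F n) by exact: bigcapT_measurable.
have h : mu (F n) @[n --> \oo] --> mu (\bigcap_n F n).
  apply: nonincreasing_cvg_mu => //.
    by rewrite ltey_eq fin_num_measure.
  by apply/nonincreasing_seqP => n; apply/subsetPset/dF.
have : \forall n \near \oo, (mu (F n) < e%:E)%E.
  apply: (h (fun x => (x < e%:E)%E)).
  by apply: open_ereal_lt'; rewrite (prE mcap) F0 lte_fin.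
by move=> [n _ /(_ n (leqnn n))/=]; rewrite prE// lte_fin => ?; exists n.
Qed.

Lemma pr_bigcup0 (F : nat -> set X) : (forall n, measurable (F n)) ->
  (forall n, pr (F n) = 0) -> pr (\bigcup_n F n) = 0.
Proof.
move=> mF F0; rewrite /pr (_ : mu _ = 0%E)//.
apply/negligibleP; first exact: bigcupT_measurable.
apply: negligible_bigcup => n; apply/negligibleP => //.
by rewrite [LHS](prE (mF n)) F0.
Qed.

End prob.

(** * Bounds for upper and lower limits of extended real sequences *)

Section extended_limits.
Variable R : realType.
Implicit Types (u : nat -> \bar R) (c : \bar R).

Lemma limn_esup_le u c : (\forall n \near \oo, (u n <= c)%E) ->
  (limn_esup u <= c)%E.
Proof.
move=> [N _ h]; rewrite limn_esup_lim; apply: lime_le; first exact: is_cvg_esups.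
exists N => // n /= Nn; apply: ge_ereal_sup => _ [m /= nm <-].
exact/h/(leq_trans Nn).
Qed.

Lemma limn_esup_ge u c : (forall N, exists2 n, (N <= n)%N & (c <= u n)%E) ->
  (c <= limn_esup u)%E.
Proof.
move=> h; rewrite limn_esup_lim; apply: lime_ge; first exact: is_cvg_esups.
near=> N; have [n Nn cn] := h N; apply: (le_trans cn).
by apply: ereal_sup_ubound; exists n.
Unshelve. all: by end_near. Qed.

Lemma limn_einf_ge u c : (\forall n \near \oo, (c <= u n)%E) ->
  (c <= limn_einf u)%E.
Proof.
move=> [N _ h]; rewrite limn_einf_lim; apply: lime_ge; first exact: is_cvg_einfs.
exists N => // n /= Nn; apply: le_ereal_inf_tmp => _ [m /= nm <-].
exact/h/(leq_trans Nn).
Qed.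

End extended_limits.

(** * Entropy and distance to a partition *)

Section entropy_function.
Variable R : realType.
Implicit Types a b x e : R.

Definition eta x : R := - (x * log2 x).

Lemma eta0 : eta 0 = 0.
Proof. by rewrite /eta mul0r oppr0. Qed.

Lemma ln2_gt0 : 0 < ln 2 :> R.
Proof. by rewrite ln_gt0// ltr1n. Qed.

Lemma eta_gap a b : 0 < a -> 0 < b -> eta a + eta b - eta (a + b) =
  (a * (ln (a + b) - ln a) + b * (ln (a + b) - ln b)) / ln 2.
Proof. by move=> a0 b0; rewrite /eta /log2; have := ln2_gt0 => ?; field; lra. Qed.

(** If [a <= b], then [ln (a + b) - ln a >= ln 2], so the smaller piece alone contributes at least
    [a] once divided by [ln 2]. *)
Lemma eta_gap_ge a b : 0 <= a -> 0 <= b ->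
  Num.min a b <= eta a + eta b - eta (a + b).
Proof.
wlog ab : a b / a <= b.
  move=> h a0 b0; have [/h|/h] := orP (le_total a b); first by apply.
  by rewrite minC (addrC a b) (addrC (eta a)); apply.
rewrite (min_idPl ab) le_eqVlt => /predU1P[<- _|a0 b0].
  by rewrite eta0 !add0r subrr.
have {}b0 : 0 < b by exact: lt_le_trans ab.
rewrite eta_gap// ler_pdivlMr ?ln2_gt0//.
have h1 : ln 2 <= ln (a + b) - ln a.
  rewrite lerBrDr -lnM ?posrE// ler_ln ?posrE//; lra.
have h2 : 0 <= ln (a + b) - ln b by rewrite subr_ge0 ler_ln ?posrE//; lra.
by nra.
Qed.

(** Put [f = e * ln 2] and let [a <= b]. Applying [ln y <= y] to [y = f * ((a + b) / a)] bounds the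
    part of [a] by [f * (a + b) + a * |ln f|]. The part of [b] is [b * ln (1 + a / b) <= a]. *)
Lemma eta_gap_le e : 0 < e -> exists2 L : R, 0 <= L & forall a b,
  0 <= a -> 0 <= b ->
  eta a + eta b - eta (a + b) <= e * (a + b) + L * Num.min a b.
Proof.
move=> e0; have l2 := ln2_gt0; pose f := e * ln 2.
have f0 : 0 < f by rewrite mulr_gt0.
exists ((1 + `|ln f|) / ln 2).
  by rewrite divr_ge0 ?addr_ge0// ltW.
move=> a b; wlog ab : a b / a <= b.
  move=> h a0 b0; have [/h|/h] := orP (le_total a b); first by apply.
  by rewrite minC (addrC a b) (addrC (eta a)); apply.
rewrite (min_idPl ab) le_eqVlt => /predU1P[<- b0|a0 b0].
  by rewrite eta0 !add0r subrr mulr0 addr0 mulr_ge0// ltW.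
have {}b0 : 0 < b by exact: lt_le_trans ab.
have s0 : 0 < a + b by lra.
rewrite eta_gap// ler_pdivrMr// mulrDl -(mulrA e) -(mulrAC _ a) divfK
  ?lt0r_neq0//.
have h1 : ln (a + b) - ln a <= f * ((a + b) / a) + `|ln f|.
  have : ln (f * ((a + b) / a)) <= f * ((a + b) / a).
    by rewrite ltW// ln_sublinear// mulr_gt0// divr_gt0.
  rewrite lnM ?ln_div ?posrE ?divr_gt0//.
  by have := ler_norm (- ln f); rewrite normrN; lra.
have h2 : ln (a + b) - ln b <= a / b.
  rewrite -ln_div ?posrE// mulrDl divff ?lt0r_neq0// addrC le_ln1Dx//.
  by have := divr_gt0 a0 b0; lra.
have h3 : a * (ln (a + b) - ln a) <= f * (a + b) + a * `|ln f|.
  apply: le_trans (ler_wpM2l (ltW a0) h1) _; rewrite mulrDr lerD2r.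
  by rewrite mulrCA (mulrCA a) divff ?lt0r_neq0// mulr1.
have h4 : b * (ln (a + b) - ln b) <= a.
  apply: le_trans (ler_wpM2l (ltW b0) h2) _.
  by rewrite mulrCA divff ?lt0r_neq0// mulr1.
by rewrite /f in h3 *; lra.
Qed.

(** Subadditivity follows from [eta_gap_ge]; the induction also carries nonnegativity of the partial
    sum. *)
Lemma eta_sum_le (I : finType) (P : pred I) (p : I -> R) :
  (forall i, 0 <= p i) -> eta (\sum_(i | P i) p i) <= \sum_(i | P i) eta (p i).
Proof.
move=> p0; suff [] : 0 <= \sum_(i | P i) p i /\
  eta (\sum_(i | P i) p i) <= \sum_(i | P i) eta (p i) by [].
elim/big_rec2: _ => [|i y x _ [x0 xy]]; first by rewrite eta0.
split; first by rewrite addr_ge0.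
have := eta_gap_ge (p0 i) x0.
have : 0 <= Num.min (p i) x by rewrite le_min p0.
lra.
Qed.

End entropy_function.

(** * Finite measurable partitions as colorings: entropy and refinement *)

Section colorings.
Context d (X : measurableType d) (R : realType) (mu : probability X R).
Local Notation pr := (pr mu).

(** A finite measurable partition is encoded by a finite-valued map, its cells being the fibers,
    some possibly empty. Refinement becomes factorization through a map of colors. *)
Definition mcoloring (I : finType) (kap : X -> I) :=
  forall i, measurable (kap @^-1` [set i]).

Lemma mcoloring_unit : mcoloring (fun _ : X => tt).
Proof.
move=> i; rewrite (_ : _ @^-1` _ = setT)//.
by apply/seteqP; split => x //= _; case: i.
Qed.

Definition with_set (I : finType) (kap : X -> I) (C : set X) (x : X) :
  (I * bool)%type := (kap x, `[< C x >]).

Definition color_entropy (I : finType) (kap : X -> I) : R :=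
  \sum_i eta (pr (kap @^-1` [set i])).

(* The distance from C to the nearest union of fibers of kap. *)
Definition color_dist (I : finType) (kap : X -> I) (C : set X) : R :=
  \sum_i Num.min (pr (kap @^-1` [set i] `&` C)) (pr (kap @^-1` [set i] `\` C)).

Lemma with_setT (I : finType) (kap : X -> I) C i :
  with_set kap C @^-1` [set (i, true)] = kap @^-1` [set i] `&` C.
Proof.
apply/seteqP; split => x /=; first by case=> <- /asboolP.
by rewrite /with_set; case=> -> /asboolT ->.
Qed.

Lemma with_setF (I : finType) (kap : X -> I) C i :
  with_set kap C @^-1` [set (i, false)] = kap @^-1` [set i] `\` C.
Proof.
apply/seteqP; split => x /=; first by case=> <- /asboolP.
by rewrite /with_set; case=> -> /asboolF ->.
Qed.

Lemma mcoloring_with_set (I : finType) (kap : X -> I) C :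
  mcoloring kap -> measurable C -> mcoloring (with_set kap C).
Proof.
move=> mk mC [i []]; rewrite (with_setT, with_setF).
  exact: measurableI.
exact: measurableD.
Qed.

Lemma color_entropy_with_set (I : finType) (kap : X -> I) C :
  color_entropy (with_set kap C) =
  \sum_i (eta (pr (kap @^-1` [set i] `&` C)) +
          eta (pr (kap @^-1` [set i] `\` C))).
Proof.
transitivity (\sum_i \sum_b eta (pr (with_set kap C @^-1` [set (i, b)]))).
  by rewrite pair_bigA; apply: eq_bigr => -[].
by apply: eq_bigr => i _; rewrite big_bool/= with_setT with_setF.
Qed.

Lemma color_entropy_with_set_ge (I : finType) (kap : X -> I) C :
  mcoloring kap -> measurable C ->
  color_entropy kap + color_dist kap C <= color_entropy (with_set kap C).
Proof.
move=> mk mC; rewrite color_entropy_with_set /color_entropy -big_split/=.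
apply: ler_sum => i _; rewrite (pr_split mu (mk i) mC).
have := eta_gap_ge (pr_ge0 mu (kap @^-1` [set i] `&` C)) (pr_ge0 mu (kap @^-1`
  [set i] `\` C)).
lra.
Qed.

(** The terms [e * (a + b)] of [eta_gap_le] add up to [e] over all fibers, so [L] depends on [e]
    only, not on the number of colors. *)
Lemma color_entropy_with_set_le (e : R) : 0 < e -> exists2 L : R, 0 <= L &
  forall (I : finType) (kap : X -> I) C, mcoloring kap -> measurable C ->
  color_entropy (with_set kap C) <=
    color_entropy kap + (e + L * color_dist kap C).
Proof.
move=> e0; have [L L0 hL] := eta_gap_le e0; exists L => // I kap C mk mC.
rewrite color_entropy_with_set /color_entropy.
have -> : e = \sum_i e * pr (kap @^-1` [set i]).
  rewrite -mulr_sumr -[LHS]mulr1 -(pr_setT mu) (pr_fibers mu mk measurableT).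
  by under eq_bigr do rewrite setTI.
rewrite /color_dist mulr_sumr -!big_split/=.
apply: ler_sum => i _; rewrite (pr_split mu (mk i) mC).
have := hL _ _ (pr_ge0 mu (kap @^-1` [set i] `&` C)) (pr_ge0 mu (kap @^-1` [set
  i] `\` C)).
lra.
Qed.

Section refinement.
Variables (I J : finType) (kap : X -> I) (lam : X -> J) (h : J -> I).
Hypotheses (mk : mcoloring kap) (ml : mcoloring lam).
Hypothesis klh : kap = h \o lam.

Lemma pr_coarse_fiber i A : measurable A ->
  pr (kap @^-1` [set i] `&` A) =
  \sum_(j | h j == i) pr (lam @^-1` [set j] `&` A).
Proof.
move=> mA; rewrite (pr_fibers mu ml (measurableI _ _ (mk i) mA)).
rewrite [RHS]big_mkcond; apply: eq_bigr => j _; case: ifPn => [/eqP hj|hj].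
  congr (pr _); apply/seteqP; split => x /=; rewrite klh/=; last by move=> [-> ?].
  by tauto.
rewrite -(pr_set0 mu); congr (pr _); apply/seteqP; split => // x/= [[]].
by rewrite klh/= => + _ lj; rewrite lj => /eqP; rewrite (negbTE hj).
Qed.

Lemma color_entropy_refine : color_entropy kap <= color_entropy lam.
Proof.
rewrite /color_entropy [leRHS](partition_big h xpredT)//=.
apply: ler_sum => i _.
rewrite -[_ @^-1` _]setIT pr_coarse_fiber//.
rewrite [X in eta X](eq_bigr (fun j => pr (lam @^-1` [set j]))) => [|j _];
  last first.
  by rewrite setIT.
by apply: eta_sum_le => j; exact: pr_ge0.
Qed.

(** Within one coarse fiber, a sum of minima is at most the minimum of the two sums. *)
Lemma color_dist_refine C : measurable C ->
  color_dist lam C <= color_dist kap C.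
Proof.
move=> mC; rewrite /color_dist [leLHS](partition_big h xpredT)//=.
apply: ler_sum => i _; rewrite setDE !pr_coarse_fiber//; last exact: measurableC.
by rewrite le_min; apply/andP; split; apply: ler_sum => j _;
  rewrite ge_min setDE lexx ?orbT.
Qed.

End refinement.

(** The type of colors grows with each added set, so [color_by] is dependently typed. Started from
    the constant [tt], its nonempty fibers are the nonempty cells of [set_join C n]. *)
Fixpoint color_type (I : finType) (n : nat) : finType :=
  if n is m.+1 then (color_type I m * bool)%type else I.

Fixpoint color_by (I : finType) (kap : X -> I) (C : nat -> set X) (n : nat) :
    X -> color_type I n :=
  if n is m.+1 then with_set (color_by kap C m) (C m) else kap.

Lemma mcoloring_color_by (I : finType) (kap : X -> I) C n :
  mcoloring kap -> (forall k, measurable (C k)) -> mcoloring (color_by kap C n).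
Proof.
by move=> mk mC; elim: n => //= n ih; exact: mcoloring_with_set.
Qed.

Lemma color_by_base (I : finType) (kap : X -> I) C n :
  exists h : color_type I n -> I, kap = h \o color_by kap C n.
Proof.
elim: n => [|n [h hE]]; first by exists id.
by exists (h \o fst); rewrite {1}hE.
Qed.

Lemma color_by_trivial (I : finType) (kap : X -> I) C n :
  exists h : color_type I n -> color_type unit n,
    color_by (fun=> tt) C n = h \o color_by kap C n.
Proof.
elim: n => [|n [h hE]]; first by exists (fun=> tt).
by exists (fun p => (h p.1, p.2)); rewrite /= hE.
Qed.

Lemma color_by_eq C n x y :
  color_by (fun=> tt) C n x = color_by (fun=> tt) C n y <->
  (forall k, (k < n)%N -> (C k x <-> C k y)).
Proof.
elim: n => [|n ih]/=; first by [].
split=> [[/ih h1 h2] k|h].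
  rewrite ltnS leq_eqVlt => /predU1P[->|/h1//].
  by rewrite -[C n x]asboolE h2 asboolE.
rewrite /with_set; congr pair; first by apply/ih => k kn; apply: h; exact: ltnW.
by apply: asbool_equiv_eq; exact: h.
Qed.

Lemma color_by_ext C C' n : (forall k, (k < n)%N -> C k = C' k) ->
  color_by (fun=> tt) C n = color_by (fun=> tt) C' n.
Proof.
elim: n => //= n ih h; rewrite ih ?h// => k kn; apply: h; exact: ltnW.
Qed.

(** Several colors may share the empty fiber, which a set of sets counts once. As [phi set0 = 0],
    both sums reduce to nonempty fibers, where a color is determined by its fiber. *)
Lemma sum_fibers (I : finType) (kap : X -> I) (phi : set X -> R)
    (P : set (set X)) : phi set0 = 0 ->
  (forall A, A !=set0 -> (P A <-> exists i, A = kap @^-1` [set i])) ->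
  \sum_(A \in P) phi A = \sum_i phi (kap @^-1` [set i]).
Proof.
move=> phi0 hP.
pose J := [set i | kap @^-1` [set i] !=set0].
transitivity (\sum_(A \in [set kap @^-1` [set i] | i in J]) phi A).
  apply/esym/fsbig_widen => [_ [i Ji <-]|A [PA nA]/=].
    by apply/hP => //; exists i.
  have [/eqP->//|/set0P A0] := boolP (A == set0).
  by have [i Ai] := (hP A A0).1 PA; case: nA; exists i => //; rewrite /J/= -Ai.
rewrite fsbig_image/=; last first.
  move=> i j /set_mem [x xi] _ e.
  have : (kap @^-1` [set j]) x by rewrite -e.
  by rewrite -xi.
rewrite (@fsbig_widen _ _ _ _ J setT)//; last first.
  move=> i [_ /=]; rewrite /J/=; have [/eqP->//|/set0P//] :=
    boolP (kap @^-1` [set i] == set0).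
rewrite (fsbigE (index_enum I))/= ?index_enum_uniq//.
  by apply: eq_bigl => i; rewrite in_setT.
by move=> i _; rewrite mem_index_enum.
Qed.

Lemma partition_entropy_set_join C n :
  partition_entropy mu (set_join C n) = color_entropy (color_by (fun=> tt) C n).
Proof.
rewrite /partition_entropy (@sum_fibers _ (color_by (fun=> tt) C n) (fun A =>
  fine (mu A) * log2 (fine (mu A)))).
- by rewrite -sumrN.
- by rewrite measure0 mul0r.
move=> A [x Ax]; split.
  move=> [s _ sA]; exists (color_by (fun=> tt) C n x).
  rewrite -sA in Ax *; apply/seteqP; split => y.
    move=> sy; apply/color_by_eq => k kn; move: (sy k kn) (Ax k kn).
    by case: (s k).
  move=> /color_by_eq h k kn; move: (Ax k kn) (h k kn); case: (s k) => /=; tauto.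
move=> [i iA]; rewrite iA in Ax *; exists (fun k => `[< C k x >]) => //.
move: Ax => /= <-; apply/seteqP; split => y.
  move=> h; apply/color_by_eq => k kn; move: (h k kn).
  by case: asboolP => /=; tauto.
move=> /color_by_eq h k kn; move: (h k kn).
by case: asboolP => /=; tauto.
Qed.

(** * Families of zero and of positive entropy *)

Section positive_entropy.
Variables (F : set (set X)) (mF : F `<=` measurable).

(** Each set adds at least [del], so the join of [n] sets has entropy at least [n * del]. *)
Lemma sequence_entropy_ge (C : nat -> set X) (del : R) : (forall k, F (C k)) ->
  (forall n, del <= color_dist (color_by (fun=> tt) C n) (C n)) ->
  (del%:E <= sequence_entropy mu C)%E.
Proof.
move=> FC h.
have mc n : mcoloring (color_by (fun=> tt) C n).
  by apply: mcoloring_color_by => [|k]; [exact: mcoloring_unit|exact/mF].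
(* The bound starts at [n = 1], because at [n = 0] the quotient is 0. *)
apply: limn_einf_ge; exists 1%N => // n /= n0.
rewrite lee_fin ler_pdivlMl ?ltr0n// partition_entropy_set_join.
elim: n {n0} => [|n ih].
  rewrite mul0r /color_entropy big1// => -[] _.
  rewrite (_ : _ @^-1` _ = setT); last by apply/seteqP; split => x.
  by rewrite pr_setT /eta /log2 ln1 mul0r mulr0 oppr0.
rewrite /= -natr1 mulrDl mul1r.
apply: le_trans (color_entropy_with_set_ge (mc n) (mF (FC n))).
exact: lerD.
Qed.

(** The empty family has entropy [-oo], the supremum of the empty set. *)
Lemma family_entropy0_nonempty : family_entropy mu F = 0%E -> F !=set0.
Proof.
move=> F0; apply/set0P/eqP => Fe; move: F0; rewrite /family_entropy Fe.
rewrite (_ : [set _ | _ in _] = set0) ?ereal_sup0//.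
by apply/seteqP; split => [x [C h _]|//]; exact: (h 0%N).
Qed.

(* If no such sequence existed, one could greedily choose sets of F each adding
   at least del to the entropy. *)
Lemma family_entropy0 : family_entropy mu F = 0%E -> forall del : R, 0 < del ->
  exists n (C : nat -> set X), (forall k, F (C k)) /\
    forall B, F B -> color_dist (color_by (fun=> tt) C n) B < del.
Proof.
move=> F0 del del0; apply: contrapT => hn.
have [B0 FB0] := family_entropy0_nonempty F0.
(* The condition on [C] stands under the existential so that [choice] gives a function on all
   lists. *)
have next n (C : nat -> set X) : exists B, (forall k, F (C k)) -> F B /\
    del <= color_dist (color_by (fun=> tt) C n) B.
  have [FC|nFC] := pselect (forall k, F (C k)); last by exists set0 => /nFC.
  apply: contrapT => nB; apply: hn; exists n, C; split => // B FB.
  by rewrite ltNge; apply/negP => le; apply: nB; exists B.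
have {}next : forall l : seq (set X), exists B, (forall k, F (nth B0 l k)) ->
    F B /\ del <= color_dist (color_by (fun=> tt) (nth B0 l) (size l)) B.
  by move=> l; exact: next.
have [nxt nxtP] := choice next.
(* Each new set depends on all earlier ones, so the recursion runs on lists; the default [B0] of
   [nth] keeps every entry in [F]. *)
pose fix ls n := if n is m.+1 then rcons (ls m) (nxt (ls m)) else [::].
pose C n := nxt (ls n).
have lsE n : ls n = mkseq C n by elim: n => // n ih; rewrite mkseqS -ih.
have Fl n : forall k, F (nth B0 (ls n) k).
  elim: n => [|n ih] k/=; first by rewrite nth_nil.
  by rewrite nth_rcons; case: ifP => // _; case: ifP => // _;
    exact: (nxtP _ ih).1.
have FC k : F (C k) := (nxtP _ (Fl k)).1.
suff : (del%:E <= 0 :> \bar R)%E by rewrite lee_fin leNgt del0.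
rewrite -F0; apply: le_trans (sequence_entropy_ge FC _) _ => [n|].
  have := (nxtP _ (Fl n)).2; rewrite lsE size_mkseq.
  rewrite (@color_by_ext (nth B0 (mkseq C n)) C)//.
    by rewrite -lsE.
  by move=> k kn; rewrite nth_mkseq.
by apply: ereal_sup_ubound; exists C.
Qed.

(** Contrapositive: if one coloring is close to all sets of [F], each further set adds little
    entropy beyond that of the coloring, whose own entropy is a constant that disappears after
    division by [n]. *)
Lemma family_entropy_gt0 : (0 < family_entropy mu F)%E ->
  exists2 del : R, 0 < del & forall (I : finType) (kap : X -> I),
    mcoloring kap -> exists2 C, F C & del <= color_dist kap C.
Proof.
move=> F0; apply: contrapT => hn.
have {hn} small (del : R) : 0 < del -> exists (I : finType) (kap : X -> I),
    mcoloring kap /\ forall C, F C -> color_dist kap C < del.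
  move=> del0; apply: contrapT => h; apply: hn; exists del => // I kap mk.
  apply: contrapT => h'; apply: h; exists I, kap; split => // C FC.
  by rewrite ltNge; apply/negP => ?; apply: h'; exists C.
move: F0; rewrite ltNge => /negP; apply.
apply: ge_ereal_sup => _ [C FC <-].
apply/lee_addgt0Pr => e e0; rewrite add0e.
have e40 : 0 < e / 4 by rewrite divr_gt0.
have [L L0 hL] := color_entropy_with_set_le e40.
(* This makes [L * color_dist] at most [e / 4], so each added set costs at most [e / 2]. *)
have del0 : 0 < e / 4 / (L + 1) by rewrite divr_gt0// ltr_wpDl.
have [I [kap [mk hk]]] := small _ del0.
have mC k : measurable (C k) by exact/mF.
have mc n : mcoloring (color_by kap C n) by exact: mcoloring_color_by.
have mt n : mcoloring (color_by (fun=> tt) C n).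
  by apply: mcoloring_color_by => //; exact: mcoloring_unit.
have step n : color_entropy (color_by kap C n) <=
    color_entropy kap + n%:R * (e / 2).
  elim: n => [|n ih]; first by rewrite mul0r addr0.
  apply: le_trans (hL _ _ _ (mc n) (mC n)) _.
  rewrite -[n.+1]addn1 natrD mulrDl mul1r; move: ih.
  have [h hE] := color_by_base kap C n.
  have := color_dist_refine mk (mc n) hE (mC n).
  have := hk _ (FC n); rewrite ltr_pdivlMr ?ltr_wpDl// => h1 h2 ih.
  have : 0 <= color_dist (color_by kap C n) (C n).
    by apply: sumr_ge0 => i _; rewrite le_min !pr_ge0.
  move: (n%:R * (e / 2)) ih h1 h2 => w; nra.
rewrite /sequence_entropy limn_einf_lim.
apply: lime_le; first exact: is_cvg_einfs.
near=> n.
have n0 : (0 < n)%N by near: n; exists 1%N.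
apply: (@le_trans _ _ (n%:R^-1 * partition_entropy mu (set_join C n))%:E).
  by apply: ereal_inf_lbound; exists n => //=.
rewrite lee_fin ler_pdivrMl ?ltr0n// partition_entropy_set_join.
have [h hE] := color_by_trivial kap C n.
apply: le_trans (color_entropy_refine (mt n) (mc n) hE) _.
apply: le_trans (step n) _.
(* The other half of [e] absorbs the entropy of the initial coloring for large [n]. *)
suff : color_entropy kap <= n%:R * (e / 2) by lra.
rewrite -ler_pdivrMr ?divr_gt0//.
near: n; exact: nbhs_infty_ger.
Unshelve. all: by end_near. Qed.

(** The unions of fibers of one coloring form a finite net for the family in measure. Weak mixing is
    uniform over the finitely many pairs in the net, and [mixing_mean_lip] transfers this to the
    family. *)
Lemma uniformly_weak_mixing_entropy0 T : measure_preserving mu T ->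
  weak_mixing mu T -> family_entropy mu F = 0%E ->
  uniformly_weak_mixing_on mu T F.
Proof.
move=> mpT wmT F0.
have [B0 FB0] := family_entropy0_nonempty F0.
apply: limn_esup_le_cvg; last first.
  move=> n; apply: le_trans (ereal_sup_ubound _); last first.
    by exists B0 => //; exists B0.
  by rewrite lee_fin mixing_mean_ge0.
apply/lee_addgt0Pr => e e0; rewrite add0e.
(* One fifth bounds the mixing mean on the net; four come from the Lipschitz bound for two
   approximations. *)
have e50 : 0 < e / 5 by rewrite divr_gt0.
have [m [C [FC hC]]] := family_entropy0 F0 e50.
have mC k : measurable (C k) by exact/mF.
have mt : mcoloring (color_by (fun=> tt) C m).
  by apply: mcoloring_color_by => //; exact: mcoloring_unit.
set kap := color_by _ _ _ in hC mt; set I := color_type _ _ in kap hC mt.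
pose U (a : {set I}) := [set x | kap x \in a].
have mU a : measurable (U a) by exact: (measurable_fiber_pred mt (mem a)).
have near_U B : F B -> exists a, pr (B `+` U a) < e / 5.
  move=> FB; have mB := mF FB.
  (* A fiber is included when at least half of it lies in [B]; the error in it is then the minimum
     summed in [color_dist]. *)
  pose a := [set i | pr (kap @^-1` [set i] `\` B) <=
                     pr (kap @^-1` [set i] `&` B)]%SET.
  exists a; apply: le_lt_trans (hC _ FB).
  have mY := measurableY mB (mU a); rewrite (pr_fibers mu mt mY).
  apply: ler_sum => i _; have mYi := measurableI _ _ mY (mt i).
  have mi1 : measurable (kap @^-1` [set i] `&` B) by exact: measurableI.
  have mi2 : measurable (kap @^-1` [set i] `\` B) by exact: measurableD.
  have [ai|nai] := boolP (i \in a).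
    suff h : pr ((B `+` U a) `&` kap @^-1` [set i]) <=
             pr (kap @^-1` [set i] `\` B).
      by rewrite le_min h (le_trans h)//; rewrite inE in ai.
    apply: pr_le => //.
    rewrite setY_def => x /= [[[Bx nU]|[_ nB]] xi]; last by split.
    by case: nU; rewrite /U/= xi.
  suff h : pr ((B `+` U a) `&` kap @^-1` [set i]) <=
           pr (kap @^-1` [set i] `&` B).
    by rewrite le_min h (le_trans h)//; rewrite inE -ltNge in nai; exact: ltW.
  apply: pr_le => //.
  rewrite setY_def => x /= [[[Bx _]|[Ux _]] xi]; first by split.
  by move: Ux; rewrite /U/= xi (negbTE nai).
have unif : \forall n \near \oo, forall p : {set I} * {set I},
    mixing_mean mu T (U p.1) (U p.2) n < e / 5.
  have h (p : {set I} * {set I}) : \forall n \near \oo,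
      mixing_mean mu T (U p.1) (U p.2) n < e / 5.
    have /cvgrPdist_lt/(_ _ e50) := wmT _ _ (mU p.1) (mU p.2).
    by apply: filterS => n; rewrite sub0r normrN; apply: le_lt_trans (ler_norm _).
  exact: filter_forall.
apply: limn_esup_le; apply: filterS unif => n hn.
apply: ge_ereal_sup => _ [A FA [B FB <-]]; rewrite lee_fin.
have [a ha] := near_U A FA; have [b hb] := near_U B FB.
apply: le_trans (mixing_mean_lip n mpT (mF FA) (mU a) (mF FB) (mU b)) _.
by have := hn (a, b); rewrite /=; lra.
Qed.

End positive_entropy.

End colorings.

(** * Perturbing an automorphism along its orbits *)

Section dynamics.
Context d (X : measurableType d) (R : realType) (mu : probability X R).
Local Notation pr := (pr mu).

Lemma mcoloring_factor (I J : finType) (kap : X -> I) (lam : X -> J) :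
  mcoloring lam -> (forall x y, lam x = lam y -> kap x = kap y) ->
  mcoloring kap.
Proof.
move=> ml h i.
rewrite (_ : _ @^-1` _ = [set x | `[< exists2 y, lam y = lam x & kap y = i >]]).
  exact: (measurable_fiber_pred ml (fun j =>
    `[< exists2 y, lam y = j & kap y = i >])).
apply/seteqP; split => x /=; first by move=> xi; apply/asboolP; exists x.
by move=> /asboolP[y /h <-].
Qed.

Lemma measurable_fibers (I : finType) (kap : X -> I) (V : set X) :
  mcoloring kap -> (forall i, measurable (V `&` kap @^-1` [set i])) ->
  measurable V.
Proof.
move=> mk mV.
rewrite (_ : V = \big[setU/set0]_i (V `&` kap @^-1` [set i])).
  exact: bigsetU_measurable.
rewrite -bigcup_seq/=; apply/seteqP; split => x; last by case=> i _ [].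
by move=> Vx; exists (kap x) => //=; rewrite mem_index_enum.
Qed.

Lemma measure_bigcup_eq (K L : nat -> set X) :
  (forall n, measurable (K n)) -> (forall n, measurable (L n)) ->
  trivIset setT K -> trivIset setT L -> (forall n, pr (K n) = pr (L n)) ->
  pr (\bigcup_n K n) = pr (\bigcup_n L n).
Proof.
move=> mK mL tK tL KL; rewrite /pr; congr fine.
rewrite !measure_semi_bigcup//; try exact: bigcupT_measurable.
by apply: eq_eseriesr => n _; rewrite [LHS](prE mu (mK n)) [RHS](prE mu (mL n))
  KL.
Qed.

Lemma mp_aut_inv (S : automorphism mu) : measure_preserving mu (aut_inv S).
Proof.
split; first exact: measurable_aut_inv.
by move=> A mA; rewrite -image_aut measure_image_aut.
Qed.

Lemma mp_aut (S : automorphism mu) : measure_preserving mu S.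
Proof. exact: aut_measure_preserving. Qed.

Definition aut_symm (phi : automorphism mu) : automorphism mu :=
  Automorphism (@aut_invK _ _ _ _ phi) (@autK _ _ _ _ phi) (mp_aut_inv phi)
    (mp_aut phi).1.

(** Nonatomicity in its intermediate value form. *)
Definition nonatomic := forall A (t : R), measurable A -> 0 <= t <= pr A ->
  exists B, [/\ measurable B, B `<=` A & pr B = t].

(** The parts of [A] inside and outside [Q] are halved separately with respect to the remaining
    sets. The union of the halves then also halves the part in [Q]; the sets of [l] may overlap. *)
Lemma halving (l : seq (set X)) : nonatomic ->
  (forall Q, Q \in l -> measurable Q) -> forall A, measurable A ->
  exists B, [/\ measurable B, B `<=` A, pr B = pr A / 2 &
    forall Q, Q \in l -> pr (B `&` Q) = pr (A `&` Q) / 2].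
Proof.
move=> na; elim: l => [|Q l ih] ml A mA.
  have [|B [mB BA prB]] := na A (pr A / 2) mA.
    by have := pr_ge0 mu A; lra.
  by exists B; split.
have mQ : measurable Q by apply: ml; rewrite mem_head.
have {}ml P : P \in l -> measurable P by move=> Pl; apply: ml;
  rewrite in_cons Pl orbT.
have mAQ := measurableI _ _ mA mQ; have mAQc := measurableD mA mQ.
have [B1 [mB1 BA1 pB1 hB1]] := ih ml _ mAQ.
have [B2 [mB2 BA2 pB2 hB2]] := ih ml _ mAQc.
have dis P : (B1 `&` P) `&` (B2 `&` P) = set0.
  apply/seteqP; split => x //= [[/BA1[_ Qx] _] [/BA2[_ nQx] _]]; exact: nQx.
exists (B1 `|` B2); split.
- exact: measurableU.
- by move=> x [/BA1[]|/BA2[]].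
- rewrite prU//; last by rewrite -(setIT B1) -(setIT B2) dis.
  by rewrite pB1 pB2 [in RHS](pr_split mu mA mQ); lra.
move=> P; rewrite in_cons => /predU1P[->|Pl].
  rewrite (_ : _ `&` Q = B1) ?pB1//; apply/seteqP; split => x /=.
    by move=> [[//|/BA2[_ nQx]] Qx].
  by move=> B1x; split; [left|exact: (BA1 _ B1x).2].
have mP := ml _ Pl.
rewrite setIUl (prU mu (measurableI _ _ mB1 mP) (measurableI _ _ mB2 mP) (dis P)).
rewrite hB1// hB2//.
rewrite [in RHS](pr_split mu (measurableI _ _ mA mP) mQ).
rewrite (setIAC A Q P) (_ : (A `\` Q) `&` P = (A `&` P) `\` Q); first lra.
by rewrite !setDE setIAC.
Qed.

(** * Recurrence and almost invariant sets of a weak mixing automorphism *)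

Section mixing_automorphism.
Variables (S : automorphism mu) (wm : weak_mixing mu S).
Hypothesis na : nonatomic.
Local Notation f := (aut_fun S).
Local Notation g := (aut_inv S).

Lemma iter_autK i : cancel (iter i f) (iter i g).
Proof.
elim: i => // i ih x; rewrite iterSr iterS autK; exact: ih.
Qed.

Lemma iter_aut_invK i : cancel (iter i g) (iter i f).
Proof.
elim: i => // i ih x; rewrite iterSr iterS aut_invK; exact: ih.
Qed.

Lemma measurable_iter_aut i A : measurable A -> measurable (iter i f @^-1` A).
Proof. exact: (measurable_preimage (mp_iter i (mp_aut S))). Qed.

Lemma measurable_iter_aut_inv i A :
  measurable A -> measurable (iter i g @^-1` A).
Proof. exact: (measurable_preimage (mp_iter i (mp_aut_inv S))). Qed.

Lemma pr_iter_aut i A : measurable A -> pr (iter i f @^-1` A) = pr A.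
Proof. exact: (pr_preimage (mp_iter i (mp_aut S))). Qed.

(** Every summand of the mixing mean equals [pr A * pr B], so the mean is constant for [n > 0] and
    tends to 0 only if this product is 0. *)
Lemma weak_mixing_disjoint A B : measurable A -> measurable B ->
  (forall i, A `&` iter i f @^-1` B = set0) -> pr A * pr B = 0.
Proof.
move=> mA mB h; apply/eqP; rewrite eq_le mulr_ge0 ?pr_ge0// andbT.
rewrite leNgt; apply/negP => p0.
have /cvgrPdist_lt/(_ _ p0)[N _ /(_ N.+1 (leqnSn N))/=] := wm mA mB.
rewrite sub0r normrN mixing_meanE.
rewrite (eq_bigr (fun=> pr A * pr B)) => [|i _]; last first.
  by rewrite h pr_set0 sub0r normrN ger0_norm// ltW.
rewrite sumr_const card_ord -[(pr A * pr B) *+ _]mulr_natl mulKf ?pnatr_eq0//.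
by rewrite ger0_norm ?ltxx// ltW.
Qed.

Lemma measurable_unvisited (B : set X) m : measurable B ->
  measurable [set x | forall i, (i < m)%N -> ~ B (iter i g x)].
Proof.
move=> mB.
rewrite (_ : [set _ | _] = \bigcap_(i < m) ~` (iter i g @^-1` B)).
  apply: bigcap_measurableType => i _; apply: measurableC.
  exact: measurable_iter_aut_inv.
by apply/seteqP; split.
Qed.

(** No forward orbit from [B] enters the set of points whose whole backward orbit avoids [B], so
    that set is null by [weak_mixing_disjoint]; continuity from above provides [m]. *)
Lemma visits (B : set X) (e : R) : measurable B -> 0 < pr B -> 0 < e ->
  exists m, pr [set x | forall i, (i < m)%N -> ~ B (iter i g x)] < e.
Proof.
move=> mB B0 e0.
pose W m := [set x | forall i, (i < m)%N -> ~ B (iter i g x)].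
have mW m : measurable (W m) by exact: measurable_unvisited.
apply: pr_nonincreasing => //.
  by move=> n x h i lin; apply: h; exact: ltnW.
have mWoo : measurable (\bigcap_n W n) by exact: bigcapT_measurable.
suff /eqP : pr B * pr (\bigcap_n W n) = 0.
  by rewrite mulf_eq0 (gt_eqF B0) => /eqP.
apply: weak_mixing_disjoint => // i.
apply/seteqP; split => x //= [Bx /(_ i.+1 I i (leqnn _))].
by rewrite iter_autK.
Qed.

(* Membership in V depends only on the last visited point y of a small set B:
   it means y \in B', where B' halves the finitely many relevant return patterns. *)
Lemma almost_invariant (l : seq (set X)) (e : R) : 0 < e ->
  (forall Q, Q \in l -> measurable Q) ->
  exists V, [/\ measurable V, pr (V `\` f @^-1` V) <= e &
    forall Q, Q \in l -> pr (V `&` Q) = pr Q / 2].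
Proof.
move=> e0 ml.
have [|B [mB _ pB]] := na (t := Num.min 1 (e / 2)) measurableT.
  by rewrite pr_setT ge_min lexx/= le_min; lra.
have B0 : 0 < pr B by rewrite pB lt_min; lra.
have Be : pr B <= e / 2 by rewrite pB ge_min lexx orbT.
have e20 : 0 < e / 2 by lra.
have [m hm] := visits mB B0 e20.
pose vis x j := `[< B (iter j g x) >].
(* The time since the last visit to [B], up to [m]; it is [m.+1] if there is no such visit. *)
pose t x := find (vis x) (iota 0 m.+1).
have tE x : (t x < m.+2)%N.
  by rewrite ltnS (leq_trans (find_size _ _))// size_iota.
pose tau x : 'I_m.+2 := Ordinal (tE x).
(* With no recorded visit, the point itself is tested against [B']. *)
pose s j := if (j < m.+1)%N then j else 0%N.
have mtau : mcoloring tau.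
  pose C j := iter j g @^-1` B.
  apply: (@mcoloring_factor _ _ tau (color_by (fun=> tt) C m.+1)).
    apply: mcoloring_color_by => [|k]; first exact: mcoloring_unit.
    exact: measurable_iter_aut_inv.
  move=> x y /color_by_eq h; apply/val_inj; rewrite /= /t.
  apply: eq_in_find => j; rewrite mem_iota add0n => /andP[_ jm].
  by apply: asbool_equiv_eq; exact: h.
(* On [tau = j], membership in [V] is that of the point [s j] steps back in [B']. Pulling each piece
   of [Q] back along [f] by [s j] steps reduces halving by [V] to halving by [B']. *)
pose ql := [seq iter (s j) f @^-1` (Q `&` tau @^-1` [set j]) |
  Q : set X <- l, j : 'I_m.+2 <- enum 'I_m.+2].
have mql P : P \in ql -> measurable P.
  move=> /allpairsP[[Q j] /= [Ql _ ->]]; apply: measurable_iter_aut.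
  by apply: measurableI; [exact: ml|exact: mtau].
have [B' [mB' _ _ hB']] := halving na mql measurableT.
pose V := [set x | B' (iter (s (tau x)) g x)].
have VE j : V `&` tau @^-1` [set j] = iter (s j) g @^-1` B' `&` tau @^-1` [set j].
  by apply/seteqP; split => x [h xj]; split => //; move: h;
    rewrite /V /preimage /mkset (xj : tau x = j).
have mV : measurable V.
  apply: (measurable_fibers mtau) => j; rewrite VE.
  by apply: measurableI => //; exact: measurable_iter_aut_inv.
exists V; split => //.
- pose W := [set x | forall i, (i < m)%N -> ~ B (iter i g x)].
  have mW : measurable W by exact: measurable_unvisited.
  have mfB : measurable (f @^-1` B) by exact: (@measurable_iter_aut 1).
  (* If [f x] is not in [B] and [x] has visited [B] at one of the times below [m], then [x] and
     [f x] have the same last visited point, hence the same status in [V]. *)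
  apply: (@le_trans _ _ (pr (f @^-1` B `|` W))).
    apply: pr_le; [apply: measurableD => //;
      exact: (@measurable_iter_aut 1)|exact: measurableU|].
    move=> x [Vx nVx]; apply: contrapT => /not_orP[nB nW]; apply: nVx.
    have [i im Bi] : exists2 i, (i < m)%N & B (iter i g x).
      apply: contrapT => h; apply: nW => i im Bi; apply: h; by exists i.
    have txm : (t x < m)%N.
      rewrite (leq_ltn_trans _ im)// leqNgt; apply/negP => it.
      have := before_find 0%N it; rewrite nth_iota ?add0n; last by lia.
      by move/asboolP.
    have tfx : t (f x) = (t x).+1.
      rewrite /t -[in RHS](addn1 m) iotaD find_cat ifT; last first.
        apply/hasP; exists i; last exact/asboolP.
        by rewrite mem_iota add0n.
      rewrite /= {1}/vis/= asboolF// (iotaDl 1 0) find_map; congr _.+1.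
      by apply: eq_find => j; rewrite /= /vis add1n iterSr autK.
    have sfx : s (tau (f x)) = (t x).+1 by rewrite /s /= tfx ltnS txm.
    have sx : s (tau x) = t x by rewrite /s /= ltnS ltnW.
    by rewrite /V /preimage /mkset sfx iterSr autK; move: Vx;
      rewrite /V /mkset sx.
  apply: le_trans (prU_le _ _ _) _ => //.
  have := @pr_iter_aut 1 _ mB; rewrite /= => ->.
  by have := ltW hm; rewrite -/W; lra.
move=> Q Ql; have mQ := ml _ Ql.
rewrite (pr_fibers mu mtau mQ) (pr_fibers mu mtau (measurableI _ _ mV mQ)).
rewrite mulr_suml; apply: eq_bigr => j _.
have := hB' (iter (s j) f @^-1` (Q `&` tau @^-1` [set j])) _.
rewrite setTI pr_iter_aut; last exact: measurableI.
move=> <-; last by apply/allpairsP; exists (Q, j); rewrite /= mem_enum.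
rewrite setIAC VE -(@pr_iter_aut (s j)); last first.
  do 2 (apply: measurableI => //); exact: measurable_iter_aut_inv.
congr (pr _); apply/seteqP; split => x /=; rewrite iter_autK; tauto.
Qed.

(** * Exchanging two sets by a matching along orbits *)

Section swap.
Variables (I : finType) (kap : X -> I) (mk : mcoloring kap).
Variables (E F : set X) (mE : measurable E) (mF : measurable F).
Hypothesis EF0 : E `&` F = set0.
Hypothesis EF : forall i,
  pr (E `&` kap @^-1` [set i]) = pr (F `&` kap @^-1` [set i]).

(* Greedy matching of points x of E with points f^n x of F of the same color;
   ergodicity makes it exhaust E and F up to null sets. *)
Fixpoint unmatched (n : nat) : set X * set X :=
  if n is m.+1 then
    let: (E', F') := unmatched m in
    (E' `\` [set x | F' (iter m f x) /\ kap (iter m f x) = kap x],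
     F' `\` [set x | E' (iter m g x) /\ kap (iter m g x) = kap x])
  else (E, F).

(** [En] and [Fn] are what remains before stage [n]; [K n] consists of the points of [E] matched at
    stage [n], and [L n] of their partners under [iter n f]. *)
Let En n := (unmatched n).1.
Let Fn n := (unmatched n).2.
Let K n := En n `&` [set x | Fn n (iter n f x) /\ kap (iter n f x) = kap x].
Let L n := Fn n `&` [set x | En n (iter n g x) /\ kap (iter n g x) = kap x].

Let EnS n : En n.+1 = En n `\` K n.
Proof.
rewrite /K /En /Fn /=; case: unmatched => E' F' /=.
by apply/seteqP; split => x [h h']; split => // k; apply: h' => //; case: k.
Qed.

Let FnS n : Fn n.+1 = Fn n `\` L n.
Proof.
rewrite /L /En /Fn /=; case: unmatched => E' F' /=.
by apply/seteqP; split => x [h h']; split => // k; apply: h' => //; case: k.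
Qed.

Let En_sub n k : En (k + n)%N `<=` En n.
Proof. by elim: k => // k ih; rewrite addSn EnS => x [/ih]. Qed.

Let Fn_sub n k : Fn (k + n)%N `<=` Fn n.
Proof. by elim: k => // k ih; rewrite addSn FnS => x [/ih]. Qed.

Let EnE n : En n `<=` E.
Proof. by have := @En_sub 0%N n; rewrite addn0. Qed.

Let FnF n : Fn n `<=` F.
Proof. by have := @Fn_sub 0%N n; rewrite addn0. Qed.

Let KL n x : K n x <-> L n (iter n f x).
Proof.
rewrite /K /L /= iter_autK; split => [[? []]|[? []]] //.
Qed.

Let LK n x : L n x <-> K n (iter n g x).
Proof. by rewrite KL iter_aut_invK. Qed.

Let measurable_same_color (h : X -> X) : measure_preserving mu h ->
  measurable [set x | kap (h x) = kap x].
Proof.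
move=> mh; apply: (measurable_fibers mk) => i.
rewrite (_ : _ `&` _ = h @^-1` (kap @^-1` [set i]) `&` kap @^-1` [set i]).
  by apply: measurableI => //; exact: (measurable_preimage mh).
apply/seteqP; split => x /= [hx xi]; split => //; by rewrite ?hx ?xi.
Qed.

Let mEFn n : measurable (En n) /\ measurable (Fn n).
Proof.
elim: n => [//|n [mEn mFn]]; rewrite EnS FnS.
have h1 := measurable_same_color (mp_iter n (mp_aut S)).
have h2 := measurable_same_color (mp_iter n (mp_aut_inv S)).
have h3 := measurable_iter_aut n mFn.
have h4 := measurable_iter_aut_inv n mEn.
split; apply: measurableD => //; apply: measurableI => //; exact: measurableI.
Qed.

Let mK n : measurable (K n).
Proof.
rewrite (_ : K n = En n `\` En n.+1).
  by apply: measurableD; exact: (mEFn _).1.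
by rewrite EnS setDD setIC setIidl// => x [].
Qed.

Let mL n : measurable (L n).
Proof.
rewrite (_ : L n = Fn n `\` Fn n.+1).
  by apply: measurableD; exact: (mEFn _).2.
by rewrite FnS setDD setIC setIidl// => x [].
Qed.

Let trivIset_removed (D P : nat -> set X) :
  (forall n, D n.+1 = D n `\` P n) -> (forall n, P n `<=` D n) ->
  (forall n k, D (k + n)%N `<=` D n) -> trivIset setT P.
Proof.
move=> DS PD Dsub.
have h n m x : (n < m)%N -> P n x -> ~ P m x.
  by move=> nm Pn /PD; rewrite -(subnK nm) => /Dsub; rewrite DS => -[_]; exact.
move=> i j _ _ [x [Pi Pj]]; case: (ltngtP i j) => // ij.
  by have := h _ _ _ ij Pi.
by have := h _ _ _ ij Pj.
Qed.

Let tK : trivIset setT K.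
Proof. by apply: (trivIset_removed EnS) => // n x []. Qed.

Let tL : trivIset setT L.
Proof. by apply: (trivIset_removed FnS) => // n x []. Qed.

Let Koo := \bigcup_n K n.
Let Loo := \bigcup_n L n.

Let mKoo : measurable Koo. Proof. exact: bigcupT_measurable. Qed.
Let mLoo : measurable Loo. Proof. exact: bigcupT_measurable. Qed.

Let KE : Koo `<=` E. Proof. by move=> x [n _ [/EnE]]. Qed.
Let LF : Loo `<=` F. Proof. by move=> x [n _ [/FnF]]. Qed.

Let K_not_L x : Koo x -> ~ Loo x.
Proof.
by move=> /KE Ex /LF Fx; have : (E `&` F) x by []; rewrite EF0.
Qed.

(** [iter n f] carries [K n] onto [L n] preserving measure, and [A] to [A'] there; the pieces are
    disjoint, so their measures add up. *)
Let prK A A' : measurable A -> measurable A' ->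
  (forall n x, K n x -> (A x <-> A' (iter n f x))) ->
  pr (A `&` Koo) = pr (A' `&` Loo).
Proof.
move=> mA mA' AA'; rewrite /Koo /Loo !setI_bigcupr.
apply: measure_bigcup_eq => //.
- by move=> n; exact: measurableI.
- by move=> n; exact: measurableI.
- by apply: trivIset_setIl; exact: tK.
- by apply: trivIset_setIl; exact: tL.
move=> n; rewrite -[RHS](pr_iter_aut n); last exact: measurableI.
congr (pr _); apply/seteqP; split => x /= [Ax Kx].
  by split; [apply/(AA' _ _ Kx)|apply/KL].
by move/KL in Kx; split => //; apply/(AA' _ _ Kx).
Qed.

(** Each matched pair is exchanged and all other points are fixed. The stage found by [xget] is
    unique because the [K n], and likewise the [L n], are disjoint. *)
Definition match_fun (x : X) : X :=
  if `[< Koo x >] then iter (xget 0%N [set n | K n x]) f x else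
  if `[< Loo x >] then iter (xget 0%N [set n | L n x]) g x else x.

Let match_K n x : K n x -> match_fun x = iter n f x.
Proof.
move=> Kx; rewrite /match_fun asboolT; last by exists n.
rewrite (@xget_unique _ _ _ n)// => m Km; apply: tK => //.
by exists x.
Qed.

Let match_L n x : L n x -> match_fun x = iter n g x.
Proof.
move=> Lx; have Lo : Loo x by exists n.
rewrite /match_fun asboolF => [|/K_not_L//]; rewrite asboolT//.
rewrite (@xget_unique _ _ _ n)// => m Lm; apply: tL => //.
by exists x.
Qed.

Let match_id x : ~ Koo x -> ~ Loo x -> match_fun x = x.
Proof. by move=> nK nL; rewrite /match_fun !asboolF. Qed.

Let match_invol : involutive match_fun.
Proof.
move=> x; have [[n _ Kx]|nK] := pselect (Koo x).
  by rewrite (match_K Kx) (@match_L n) ?iter_autK//; exact/KL.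
have [[n _ Lx]|nL] := pselect (Loo x).
  by rewrite (match_L Lx) (@match_K n) ?iter_aut_invK//; exact/LK.
by rewrite !match_id.
Qed.

Let match_color x : kap (match_fun x) = kap x.
Proof.
have [[n _ Kx]|nK] := pselect (Koo x).
  by rewrite (match_K Kx); case: Kx => _ [].
have [[n _ Lx]|nL] := pselect (Loo x).
  by rewrite (match_L Lx); case: Lx => _ [].
by rewrite match_id.
Qed.

Let match_mfun A : measurable A -> measurable (match_fun @^-1` A).
Proof.
move=> mA.
have -> : match_fun @^-1` A = (\bigcup_n (K n `&` iter n f @^-1` A)) `|`
  (\bigcup_n (L n `&` iter n g @^-1` A)) `|` (A `&` ~` (Koo `|` Loo)).
  apply/seteqP; split => x.
    move=> Ax; have [[n _ Kx]|nK] := pselect (Koo x).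
      left; left; exists n => //; split => //.
      by move: Ax; rewrite /= (match_K Kx).
    have [[n _ Lx]|nL] := pselect (Loo x).
      left; right; exists n => //; split => //.
      by move: Ax; rewrite /= (match_L Lx).
    by right; split; [move: Ax; rewrite /= match_id|case].
  move=> [[[n _ [Kx Ax]]|[n _ [Lx Ax]]]|[Ax /not_orP[nK nL]]] /=.
  - by rewrite (match_K Kx).
  - by rewrite (match_L Lx).
  - by rewrite match_id.
apply: measurableU; last first.
  by apply: measurableI => //; apply: measurableC; exact: measurableU.
apply: measurableU; apply: bigcupT_measurable => n; apply: measurableI => //.
  exact: measurable_iter_aut.
exact: measurable_iter_aut_inv.
Qed.

Let match_mp : measure_preserving mu match_fun.
Proof.
split => [_ A mA|A mA]; first by rewrite setTI; exact: match_mfun.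
have mm := match_mfun mA; rewrite !prE//; congr EFin.
rewrite (pr_split mu mm mKoo) (pr_split mu mA mKoo).
have mD := measurableD mm mKoo; have mD' := measurableD mA mKoo.
rewrite (pr_split mu mD mLoo) (pr_split mu mD' mLoo).
have e1 : pr (match_fun @^-1` A `&` Koo) = pr (A `&` Loo).
  by apply: prK => // n x Kx; rewrite /= (match_K Kx).
have e2 : pr (A `&` Koo) = pr (match_fun @^-1` A `&` Loo).
  by apply: prK => // n x Kx; rewrite /= -(match_K Kx) match_invol.
have sub A' : (A' `\` Koo) `&` Loo = A' `&` Loo.
  apply/seteqP; split => x [h Lx]; split => //; first by case: h.
  by split => // /K_not_L.
rewrite !sub e1 -e2; suff -> : match_fun @^-1` A `\` Koo `\` Loo = A `\` Koo
  `\` Loo by lra.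
by apply/seteqP; split => x [[+ nK] nL] => /= Ax; split => //; split => //;
  move: Ax; rewrite match_id.
Qed.

Definition match_aut : automorphism mu :=
  Automorphism match_invol match_invol match_mp match_mp.1.

(** Matching respects colors, so the leftovers of [E] and [F] have equal measure in each fiber. An
    orbit from one leftover to the other within a fiber would have been matched, so
    [weak_mixing_disjoint] makes the square of this measure 0. *)
Let rest0 : pr (E `\` Koo) = 0 /\ pr (F `\` Loo) = 0.
Proof.
have mE' := measurableD mE mKoo; have mF' := measurableD mF mLoo.
have eq i : pr ((E `\` Koo) `&` kap @^-1` [set i]) =
            pr ((F `\` Loo) `&` kap @^-1` [set i]).
  have h1 : pr (kap @^-1` [set i] `&` Koo) = pr (kap @^-1` [set i] `&` Loo).
    by apply: prK => // n x [_ [_]] /= ->.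
  have := EF i.
  rewrite (pr_split mu (measurableI _ _ mE (mk i)) mKoo).
  rewrite (pr_split mu (measurableI _ _ mF (mk i)) mLoo).
  rewrite !setDE (setIAC E _ Koo) (setIAC E _ (~` Koo)) (setIAC F _ Loo)
    (setIAC F _ (~` Loo)).
  rewrite (setIidr KE) (setIidr LF) (setIC Koo) (setIC Loo) h1; lra.
have z i : pr ((E `\` Koo) `&` kap @^-1` [set i]) = 0.
  apply/eqP; rewrite -sqrf_eq0 expr2 {2}eq; apply/eqP.
  apply: weak_mixing_disjoint; try exact: measurableI.
  move=> n; apply/seteqP; split => x //= [[[Ex nKx] xi] [[Fx nLx] fxi]].
  suff Kx : K n x by apply: nKx; exists n.
  have h m : En m x.
    elim: m => // m ih; rewrite EnS; split => // Km; apply: nKx; by exists m.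
  have h' m : Fn m (iter n f x).
    elim: m => // m ih; rewrite FnS; split => // Lm; apply: nLx; by exists m.
  by split => //; split => //; rewrite xi.
split; [rewrite (pr_fibers mu mk mE')|rewrite (pr_fibers mu mk mF')];
  rewrite big1// => i _.
by rewrite -eq.
Qed.

Lemma match_autP :
  (forall x, kap (match_aut x) = kap x) /\
  forall C D, measurable C -> measurable D -> C `\` D = E -> D `\` C = F ->
    pr ((match_aut @` C) `+` D) = 0.
Proof.
split => [|C D mC mD CD DC]; first exact: match_color.
have [r1 r2] := rest0.
have mE' := measurableD mE mKoo; have mF' := measurableD mF mLoo.
apply/eqP; rewrite eq_le pr_ge0 andbT.
apply: (@le_trans _ _ (pr ((E `\` Koo) `|` (F `\` Loo)))); last first.
  by apply: le_trans (prU_le _ mE' mF') _; rewrite r1 r2 addr0.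
apply: pr_le.
- by apply: measurableY => //; exact: measurable_image_aut.
- exact: measurableU.
rewrite image_aut setY_def => x h.
have [[n _ Kx]|nK] := pselect (Koo x).
  exfalso; have : E x by apply: KE; exists n.
  have : F (match_fun x) by rewrite (match_K Kx); apply: LF; exists n => //;
    exact/KL.
  by rewrite -CD -DC; move: h => /=; rewrite /setD/=; tauto.
have [[n _ Lx]|nL] := pselect (Loo x).
  exfalso; have : F x by apply: LF; exists n.
  have : E (match_fun x) by rewrite (match_L Lx); apply: KE; exists n => //;
    exact/LK.
  by rewrite -CD -DC; move: h => /=; rewrite /setD/=; tauto.
move: h; rewrite /setD/= match_id// -CD -DC /=; tauto.
Qed.

End swap.

(** It suffices to exchange the two differences of [C] and [D]; removing the common part leaves
    equal measures in every fiber. *)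
Lemma swap (I : finType) (kap : X -> I) (C D : set X) : mcoloring kap ->
  measurable C -> measurable D ->
  (forall i, pr (C `&` kap @^-1` [set i]) = pr (D `&` kap @^-1` [set i])) ->
  exists s : automorphism mu, (forall x, kap (s x) = kap x) /\
    pr ((s @` C) `+` D) = 0.
Proof.
move=> mk mC mD CD.
have mCD := measurableD mC mD; have mDC := measurableD mD mC.
have dis : (C `\` D) `&` (D `\` C) = set0.
  by apply/seteqP; split => // x [[? ?] [? ?]].
have eq i : pr ((C `\` D) `&` kap @^-1` [set i]) = pr ((D `\` C) `&` kap @^-1`
  [set i]).
  have := CD i.
  rewrite (pr_split mu (measurableI _ _ mC (mk i)) mD).
  rewrite (pr_split mu (measurableI _ _ mD (mk i)) mC).
  rewrite !setDE (setIAC C _ D) (setIAC C _ (~` D)) (setIAC D _ C) (setIAC D _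
    (~` C)) (setIC D C); lra.
have [h1 h2] := match_autP mk mCD mDC dis eq.
by exists (match_aut mk mCD mDC dis); split => //; exact: h2.
Qed.

(** * Correlations and the destruction of mixing *)

Definition corr i A B := pr (A `&` iter i f @^-1` B).

Lemma corrDl i A A' B : measurable A -> measurable A' -> measurable B ->
  A `&` A' = set0 -> corr i (A `|` A') B = corr i A B + corr i A' B.
Proof.
move=> mA mA' mB AA'; have mfB := measurable_iter_aut i mB.
rewrite /corr setIUl prU//; try exact: measurableI.
by apply/seteqP; split => x //= [[Ax _] [A'x _]]; rewrite -[False]/(set0 x) -AA'.
Qed.

Lemma corrDr i A B B' : measurable A -> measurable B -> measurable B' ->
  B `&` B' = set0 -> corr i A (B `|` B') = corr i A B + corr i A B'.
Proof.
move=> mA mB mB' BB'; have mfB := measurable_iter_aut i mB.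
have mfB' := measurable_iter_aut i mB'.
rewrite /corr preimage_setU setIUr prU//; try exact: measurableI.
by apply/seteqP; split => x //= [[_ Bx] [_ B'x]];
  rewrite -[False]/(set0 (iter i f x)) -BB'.
Qed.

(** A point of [V] outside [V] at time [i + 1] either leaves at the first step or is carried to a
    point of [V] outside [V] after [i] more steps. *)
Lemma escape_le V e i : measurable V -> pr (V `\` f @^-1` V) <= e ->
  pr (V `\` iter i f @^-1` V) <= i%:R * e.
Proof.
move=> mV Ve; elim: i => [|i ih].
  by rewrite (_ : _ `\` _ = set0) ?pr_set0 ?mul0r//; apply/seteqP;
    split => x // [].
have m1 := @measurable_iter_aut 1 V mV.
have mi := measurable_iter_aut i mV.
have mD := measurableD mV mi.
rewrite -addn1 natrD mulrDl mul1r -(@pr_iter_aut 1 _ mD) in ih *.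
apply: le_trans (lerD ih Ve).
have mD1 := @measurable_iter_aut 1 _ mD.
apply: le_trans (prU_le _ mD1 (measurableD mV m1)).
apply: pr_le.
- by apply: measurableD => //; exact: measurable_iter_aut.
- by apply: measurableU => //; exact: measurableD.
move=> x [Vx nVx]; have [Vfx|nVfx] := pselect (V (f x)); [left|right] => //.
by split => //; move: nVx; rewrite /= addn1 iterSr.
Qed.

(* If D+ = K + Q+ and D- = K + Q- where Q+, Q- split Z into halves that are
   nearly invariant under f^i, the two self-correlations add up to
   2[K,K] + [K,Z] + [Z,K] + [Z,Z] up to a small error. *)
Lemma split_corr i (K Z V : set X) e :
  measurable K -> measurable Z -> measurable V -> K `&` Z = set0 ->
  pr (V `\` iter i f @^-1` V) <= e -> pr (Z `&` V) = pr Z / 2 ->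
  pr Z ^+ 2 / 2 <=
    `|corr i (K `|` (Z `&` V)) (K `|` (Z `&` V)) -
      pr (K `|` (Z `&` V)) * pr (K `|` (Z `&` V))| +
    `|corr i (K `|` (Z `\` V)) (K `|` (Z `\` V)) -
      pr (K `|` (Z `\` V)) * pr (K `|` (Z `\` V))| +
    2 * `|corr i K K - pr K * pr K| + `|corr i K Z - pr K * pr Z| +
    `|corr i Z K - pr Z * pr K| + `|corr i Z Z - pr Z * pr Z| + 2 * e.
Proof.
move=> mK mZ mV KZ Ve ZV; set Qp := Z `&` V; set Qm := Z `\` V.
have mQp : measurable Qp by exact: measurableI.
have mQm : measurable Qm by exact: measurableD.
have KQp : K `&` Qp = set0 by rewrite /Qp setIA KZ set0I.
have KQm : K `&` Qm = set0 by rewrite /Qm setIDA KZ set0D.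
have QQ : Qp `&` Qm = set0 by apply/seteqP; split => x // [[_ ?] [_ ?]].
have ZQ : Z = Qp `|` Qm by rewrite setUIDK.
have pQp : pr Qp = pr Z / 2 by [].
have pQm : pr Qm = pr Z / 2.
  by have := pr_split mu mZ mV; rewrite -/Qp -/Qm; lra.
have mfV := measurable_iter_aut i mV.
have c1 : corr i Qp Qm <= e.
  apply: le_trans Ve; apply: pr_le.
  - by apply: measurableI => //; exact: measurable_iter_aut.
  - exact: measurableD.
  - by move=> x [[_ Vx] [_ nVx]].
have c2 : corr i Qm Qp <= e.
  (* [V] and its preimage have equal measure, so as much mass enters [V] as leaves it. *)
  apply: (@le_trans _ _ (pr (iter i f @^-1` V `\` V))).
    apply: pr_le.
    - by apply: measurableI => //; exact: measurable_iter_aut.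
    - exact: measurableD.
    - by move=> x [[_ nVx] [_ Vx]].
  have := pr_split mu mV mfV; have := pr_split mu mfV mV.
  by rewrite pr_iter_aut// setIC; lra.
rewrite !(corrDl _ mK mQp (measurableU _ _ mK mQp) KQp).
rewrite !(corrDl _ mK mQm (measurableU _ _ mK mQm) KQm).
rewrite !(corrDr _ _ mK mQp KQp)// !(corrDr _ _ mK mQm KQm)//.
have e1 : corr i K Z = corr i K Qp + corr i K Qm by rewrite {1}ZQ corrDr.
have e2 : corr i Z K = corr i Qp K + corr i Qm K by rewrite {1}ZQ corrDl.
have e3 : corr i Z Z = corr i Qp Qp + corr i Qm Qp + (corr i Qp Qm + corr i Qm
  Qm).
  by rewrite [in LHS]ZQ corrDr ?corrDl//; exact: measurableU.
rewrite (prU mu mK mQp KQp) (prU mu mK mQm KQm) pQp pQm.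
(* With [k], [z] the measures of [K], [Z], ideal mixing of [K] and [Z] makes the two
   self-correlations sum to [2k^2 + 2kz + z^2] up to the cross terms, while the squared measures sum
   to [2k^2 + 2kz + z^2/2]. The gap is [z^2/2]. *)
set a := (X in `|X| + _ + _ + _ + _ + _ + _);
  set b := (X in _ + `|X| + _ + _ + _ + _ + _).
have := ler_norm a; have := ler_norm b;
  have := ler_norm (pr K * pr K - corr i K K).
have := ler_norm (pr K * pr Z - corr i K Z);
  have := ler_norm (pr Z * pr K - corr i Z K).
have := ler_norm (pr Z * pr Z - corr i Z Z); rewrite !(distrC (_ * _)).
rewrite e1 e2 e3 /a /b; lra.
Qed.

Lemma destroy_mixing (I : finType) (kap : X -> I) (C : set X) (del : R) (N :
  nat) :
  mcoloring kap -> measurable C -> 0 < del -> del <= color_dist mu kap C ->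
  exists s : automorphism mu, (forall x, kap (s x) = kap x) /\
    exists2 n, (N <= n)%N & del ^+ 2 / 2 < mixing_mean mu S (s @` C) (s @` C) n.
Proof.
move=> mk mC del0 hC.
pose q i := Num.min (pr (kap @^-1` [set i] `&` C)) (pr (kap @^-1` [set i] `\` C)).
have mkC i : measurable (kap @^-1` [set i] `&` C) by exact: measurableI.
have mkCc i : measurable (kap @^-1` [set i] `\` C) by exact: measurableD.
have q0 i : 0 <= q i by rewrite le_min !pr_ge0.
have /choice[Z1 hZ1] i : exists B, [/\ measurable B,
  B `<=` kap @^-1` [set i] `&` C & pr B = q i].
  by apply: na => //; rewrite q0 ge_min lexx.
have /choice[Z2 hZ2] i : exists B, [/\ measurable B,
  B `<=` kap @^-1` [set i] `\` C & pr B = q i].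
  by apply: na => //; rewrite q0 ge_min lexx orbT.
pose W1 := [set x | Z1 (kap x) x]; pose W2 := [set x | Z2 (kap x) x].
have W1k i : W1 `&` kap @^-1` [set i] = Z1 i.
  apply/seteqP; split => [x [h <-]//|x Zx]; have [_ /(_ _ Zx)[xi _] _] := hZ1 i.
  by split => //; rewrite /W1/= xi.
have W2k i : W2 `&` kap @^-1` [set i] = Z2 i.
  apply/seteqP; split => [x [h <-]//|x Zx]; have [_ /(_ _ Zx)[xi _] _] := hZ2 i.
  by split => //; rewrite /W2/= xi.
have mW1 : measurable W1 by apply: (measurable_fibers mk) => i; rewrite W1k;
  case: (hZ1 i).
have mW2 : measurable W2 by apply: (measurable_fibers mk) => i; rewrite W2k;
  case: (hZ2 i).
have W1C : W1 `<=` C by move=> x h; have [_ /(_ _ h)[]] := hZ1 (kap x).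
have W2C x : W2 x -> ~ C x by move=> h; have [_ /(_ _ h)[]] := hZ2 (kap x).
pose Z := W1 `|` W2; pose K := C `\` W1.
have mZ : measurable Z by exact: measurableU.
have mK : measurable K by exact: measurableD.
have KZ : K `&` Z = set0.
  by apply/seteqP; split => // x [[Cx nW] [//|/W2C]].
have Zk i : pr (Z `&` kap @^-1` [set i]) = 2 * q i.
  rewrite setIUl W1k W2k; case: (hZ1 i) => m1 s1 p1; case: (hZ2 i) => m2 s2 p2.
  rewrite prU// ?p1 ?p2; first lra.
  by apply/seteqP; split => // x [/s1[_ ?] /s2[_ ?]].
have zge : 2 * del <= pr Z.
  rewrite (pr_fibers mu mk mZ); under eq_bigr do rewrite Zk.
  by rewrite -mulr_sumr ler_pM2l.
have r0 : 0 < del ^+ 2 / 8 by rewrite divr_gt0// exprn_gt0.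
have wmn A B : measurable A -> measurable B ->
    \forall n \near \oo, mixing_mean mu S A B n < del ^+ 2 / 8.
  move=> mA mB; have /cvgrPdist_lt/(_ _ r0) := wm mA mB.
  by apply: filterS => n; rewrite sub0r normrN; apply: le_lt_trans (ler_norm _).
(* The time [n] is fixed before [V], so that [V] can be chosen almost invariant up to time [n]. *)
have [n [n0 Nn [hKK hKZ hZK hZZ]]] : exists n, [/\ (0 < n)%N, (N <= n)%N &
    [/\ mixing_mean mu S K K n < del ^+ 2 / 8,
      mixing_mean mu S K Z n < del ^+ 2 / 8,
    mixing_mean mu S Z K n < del ^+ 2 / 8 & mixing_mean mu S Z Z n < del ^+ 2 /
      8]].
  near \oo => n; exists n; split.
  - by near: n; exists 1%N.
  - by near: n; exists N.
  - by split; near: n; exact: wmn.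
have e0 : 0 < del ^+ 2 / 8 / n%:R by rewrite divr_gt0 ?ltr0n.
(* Halving [Z] in each fiber gives [Dp] and [Dm] the fiberwise measure of [C], as [swap] requires;
   halving [Z] itself serves [split_corr]. *)
pose ql := Z :: [seq Z `&` kap @^-1` [set i] | i : I <- enum I].
have mql Q : Q \in ql -> measurable Q.
  rewrite in_cons => /predU1P[->//|/mapP[i _ ->]].
  by apply: measurableI.
have [V [mV Ve Vh]] := almost_invariant e0 mql.
have ZV : pr (Z `&` V) = pr Z / 2 by rewrite setIC Vh// mem_head.
have ZVk i : pr (Z `&` V `&` kap @^-1` [set i]) = q i.
  rewrite setIAC setIC Vh ?Zk; first lra.
  by rewrite in_cons; apply/orP; right; apply/mapP; exists i; rewrite ?mem_enum.
pose Dp := K `|` (Z `&` V); pose Dm := K `|` (Z `\` V).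
have mZV := measurableI _ _ mZ mV; have mZVc := measurableD mZ mV.
have mDp : measurable Dp by exact: measurableU.
have mDm : measurable Dm by exact: measurableU.
have Ck i : pr (C `&` kap @^-1` [set i]) = pr (K `&` kap @^-1` [set i]) + q i.
  rewrite (pr_split mu (measurableI _ _ mC (mk i)) mW1).
  rewrite setIAC (setIidr W1C) W1k; have [_ _ ->] := hZ1 i.
  by rewrite addrC setDE setIAC.
have Dpk i : pr (C `&` kap @^-1` [set i]) = pr (Dp `&` kap @^-1` [set i]).
  rewrite Ck setIUl prU ?ZVk//; try exact: measurableI.
  by rewrite setIACA (setIA K) KZ !set0I.
have Dmk i : pr (C `&` kap @^-1` [set i]) = pr (Dm `&` kap @^-1` [set i]).
  rewrite Ck setIUl prU//; try exact: measurableI.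
    have := pr_split mu (measurableI _ _ mZ (mk i)) mV.
    by rewrite setIAC ZVk Zk setDE setIAC -setDE; lra.
  by rewrite setIACA setDE (setIA K) KZ !set0I.
suff [D [mD hD hk]] : exists D, [/\ measurable D,
    forall i, pr (C `&` kap @^-1` [set i]) = pr (D `&` kap @^-1` [set i]) &
    del ^+ 2 / 2 < mixing_mean mu S D D n].
  have [s [sk sD]] := swap mk mC mD hD; exists s; split => //; exists n => //.
  have msC := measurable_image_aut s mC.
  apply: lt_le_trans hk _.
  apply: le_trans (mixing_mean_lip n (mp_aut S) mD msC mD msC) _.
  by rewrite setYC sD; lra.
(* As [pr Z >= 2 * del], the gap is at least [2 * del^2]. The error terms have total weight seven
   and are each at most [del^2 / 8], so more than [del^2] remains. *)
suff big : del ^+ 2 < mixing_mean mu S Dp Dp n + mixing_mean mu S Dm Dm n.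
  have [h|h] := ltP (del ^+ 2 / 2) (mixing_mean mu S Dp Dp n).
    by exists Dp.
  by exists Dm; split => //; lra.
have nV (i : 'I_n) : pr (V `\` iter i f @^-1` V) <= del ^+ 2 / 8.
  apply: le_trans (escape_le i mV Ve) _.
  rewrite mulrCA ger_pMr// ler_pdivrMr ?ltr0n// mul1r ler_nat ltnW//.
have main : n%:R * (pr Z ^+ 2 / 2) <= n%:R * (mixing_mean mu S Dp Dp n +
  mixing_mean mu S Dm Dm n +
    2 * mixing_mean mu S K K n + mixing_mean mu S K Z n + mixing_mean mu S Z K n +
    mixing_mean mu S Z Z n + 2 * (del ^+ 2 / 8)).
  have nn : (n%:R : R) != 0 by rewrite pnatr_eq0 -lt0n.
  have sumc (c : R) : n%:R * c = \sum_(i < n) c.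
    by rewrite sumr_const card_ord mulr_natl.
  have sumM A B : n%:R * mixing_mean mu S A B n = \sum_(i < n) `|corr i A B -
    pr A * pr B|.
    by rewrite mixing_meanE mulVKf.
  have dist (a b c d' e g h : R) : n%:R * (a + b + 2 * c + d' + e + g + 2 * h) =
    n%:R * a + n%:R * b + 2 * (n%:R * c) + n%:R * d' + n%:R * e + n%:R * g +
      n%:R * (2 * h).
    by ring.
  rewrite dist !sumM (sumc (2 * _)) (sumc (pr Z ^+ 2 / 2)) mulr_sumr
    -!big_split/=.
  by apply: ler_sum => i _; exact: split_corr.
have n0' : 0 < (n%:R : R) by rewrite ltr0n.
rewrite ler_pM2l// in main.
have : (2 * del) ^+ 2 <= pr Z ^+ 2 by rewrite lerXn2r// nnegrE ?pr_ge0//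
  mulr_ge0// ltW.
rewrite exprMn; move: main hKK hKZ hZK hZZ; lra.
Unshelve. all: by end_near. Qed.

End mixing_automorphism.

End dynamics.

(** * Limits of automorphisms of a Lebesgue space *)

Section lebesgue_model.
Context d (X : measurableType d) (R : realType) (mu : probability X R).
Local Notation pr := (pr mu).

(** Completeness is asked only inside [X0], where an isomorphism can transport it. *)
Definition null_complete (X0 : set X) :=
  forall Z M, measurable Z -> pr Z = 0 -> M `<=` Z `&` X0 -> measurable M.

(* F is a coordinate in [0, 1) that is injective on the conull set X0, with
   inverse G. Images of measurable sets are Borel, or else Borel modulo null
   sets, in which case all null sets must be measurable. *)
Record lebesgue_model (F : X -> R) (X0 : set X) (G : R -> X) : Prop :=
  LebesgueModel {
  model_measurable_dom : measurable X0;
  model_dom_conull : pr (~` X0) = 0;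
  model_measurable_fun : measurable_fun setT F;
  model_bounds : forall x, 0 <= F x < 1;
  model_cancel : forall x, X0 x -> G (F x) = x;
  model_itv : forall a b, a <= b -> pr (F @^-1` `[a, b]) <= b - a;
  model_image : forall A, measurable A -> exists B N : set R,
    [/\ measurable B /\ measurable N, B `<=` F @` (A `&` X0),
        F @` (A `&` X0) `<=` B `|` N, pr (F @^-1` N) = 0 &
        N = set0 \/ null_complete X0]
}.

Lemma pr_null_le A N : measurable A -> measurable N -> A `<=` N ->
  pr N = 0 -> pr A = 0.
Proof.
move=> mA mN AN N0; apply/eqP; rewrite eq_le pr_ge0 andbT -N0; exact: pr_le.
Qed.

Lemma pr_nullU A B : measurable A -> measurable B ->
  pr A = 0 -> pr B = 0 -> pr (A `|` B) = 0.
Proof.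
move=> mA mB A0 B0; apply/eqP; rewrite eq_le pr_ge0 andbT.
by apply: le_trans (prU_le _ mA mB) _; rewrite A0 B0 addr0.
Qed.

Lemma pr_eq_mod0 A B N : measurable A -> measurable B -> measurable N ->
  pr N = 0 -> (forall x, ~ N x -> (A x <-> B x)) -> pr (A `+` B) = 0.
Proof.
move=> mA mB mN N0 h; apply: (pr_null_le _ mN) => //; first exact: measurableY.
rewrite setY_def => x [[Ax nB]|[Bx nA]]; apply: contrapT => /h; tauto.
Qed.

Definition conv_in_measure (P : nat -> set X) (Q : set X) :=
  forall e : R, 0 < e -> exists N, forall k, (N <= k)%N -> pr (P k `+` Q) < e.

Lemma conv_setC (P : nat -> set X) Q : conv_in_measure P Q ->
  conv_in_measure (fun k => ~` P k) (~` Q).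
Proof.
move=> h e /h[N hN]; exists N => k /hN.
by rewrite !setY_def !setDE !setCK (setIC (~` P k)) (setIC (~` Q)) setUC.
Qed.

Lemma setYU (A A' B B' : set X) :
  (A `|` A') `+` (B `|` B') `<=` (A `+` B) `|` (A' `+` B').
Proof. by rewrite !setY_def => x; rewrite /setD/=; tauto. Qed.

Lemma conv_setU (P P' : nat -> set X) Q Q' :
  (forall k, measurable (P k)) -> (forall k, measurable (P' k)) ->
  measurable Q -> measurable Q' ->
  conv_in_measure P Q -> conv_in_measure P' Q' ->
  conv_in_measure (fun k => P k `|` P' k) (Q `|` Q').
Proof.
move=> mP mP' mQ mQ' h h' e e0.
have e20 : 0 < e / 2 by lra.
have [N hN] := h _ e20; have [N' hN'] := h' _ e20.
exists (maxn N N') => k; rewrite geq_max => /andP[/hN h1 /hN' h2].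
have m1 := measurableY (mP k) mQ; have m2 := measurableY (mP' k) mQ'.
apply: le_lt_trans (_ : pr ((P k `+` Q) `|` (P' k `+` Q')) < e).
  apply: pr_le; [|exact: measurableU|exact: setYU].
  by apply: measurableY; exact: measurableU.
by apply: le_lt_trans (prU_le _ m1 m2) _; lra.
Qed.

Section limit_map.
Variables (F : X -> R) (X0 : set X) (G : R -> X).
Hypothesis FX : lebesgue_model F X0 G.

Let mF := model_measurable_fun FX.
Let mX0 := model_measurable_dom FX.
Let X00 := model_dom_conull FX.

Lemma measurable_preimage_fun (h : X -> R) (B : set R) : measurable_fun setT h ->
  measurable B -> measurable (h @^-1` B).
Proof. by move=> mh mB; rewrite -[_ @^-1` _]setTI; exact: mh. Qed.

(** Since [F] is injective on [X0], the inner Borel approximation of the image of [A] pulls back to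
    [A] up to null sets. *)
Lemma model_modulo_null A : measurable A ->
  exists2 B : set R, measurable B & pr (A `+` F @^-1` B) = 0.
Proof.
move=> mA; have [B [N [[mB mN] BA AB N0 _]]] := model_image FX mA.
exists B => //.
have mFN := measurable_preimage_fun mF mN.
have mFB := measurable_preimage_fun mF mB.
have mX0c := measurableC mX0.
apply: (pr_eq_mod0 mA mFB (measurableU _ _ mX0c mFN)).
  exact: pr_nullU.
move=> x /not_orP[/contrapT X0x nNx]; split => [Ax|/BA[y [Ay X0y] Fyx]].
  by have [|//|//] := AB (F x) _; exists x.
by rewrite -(model_cancel FX X0x) -Fyx (model_cancel FX X0y).
Qed.

(** * Realizing a function with the law of the coordinate by a map *)

Section realization.
Variable L : X -> R.
Hypotheses (mL : measurable_fun setT L)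
  (lawL : forall B : set R, measurable B -> pr (L @^-1` B) = pr (F @^-1` B)).

Let img A := X0 `&` L @^-1` (F @` (A `&` X0)).

(** The image of [A] under [F] lies between [B] and its union with [N], and [L] pulls [N] back to a
    null set. The part beyond [B] is therefore empty or measurable by [null_complete]. *)
Let measurable_img A : measurable A -> measurable (img A) /\ pr (img A) = pr A.
Proof.
move=> mA; have [B [N [[mB mN] BA AB N0 cN]]] := model_image FX mA.
have mLN := measurable_preimage_fun mL mN.
have mLB := measurable_preimage_fun mL mB.
have LN0 : pr (L @^-1` N) = 0 by rewrite lawL.
have imgE : img A = (X0 `&` L @^-1` B) `|` (X0 `&` L @^-1` (F @` (A `&` X0) `\`
  B)).
  rewrite /img -setIUr; congr (_ `&` _); rewrite -preimage_setU;
    congr (_ @^-1` _).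
  by rewrite setDUK.
have sub : X0 `&` L @^-1` (F @` (A `&` X0) `\` B) `<=` L @^-1` N `&` X0.
  by move=> x [X0x [/AB[//|Nx] _]].
have mD : measurable (X0 `&` L @^-1` (F @` (A `&` X0) `\` B)).
  case: cN => [N0'|cN]; last exact: (cN _ _ mLN LN0 sub).
  rewrite (_ : _ `&` _ = set0)//; apply/seteqP; split => // x /sub[].
  by rewrite N0'.
have mimg : measurable (img A).
  by rewrite imgE; apply: measurableU => //; exact: measurableI.
split => //; rewrite -[LHS](@prY0_eq _ _ _ mu (L @^-1` B)) //; last first.
  apply: (pr_eq_mod0 mLB mimg (measurableU _ _ (measurableC mX0) mLN)).
    by apply: pr_nullU => //; exact: measurableC.
  move=> x /not_orP[/contrapT X0x nNx]; split => [Bx|[_ /AB[]//]].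
  by split => //; exact: BA.
rewrite lawL//.
have mFN := measurable_preimage_fun mF mN.
have mFB := measurable_preimage_fun mF mB.
apply: prY0_eq => //.
apply: (pr_eq_mod0 mFB mA (measurableU _ _ (measurableC mX0) mFN)).
  by apply: pr_nullU => //; exact: measurableC.
move=> x /not_orP[/contrapT X0x nNx]; split => [/BA[y [Ay X0y] Fyx]|Ax].
  by rewrite -(model_cancel FX X0x) -Fyx (model_cancel FX X0y).
by have [|//|//] := AB (F x) _; exists x.
Qed.

(** The map is [G] after [L] where [L] takes values in the image of [X0], and the identity
    elsewhere. The exceptional set is null since [L] and [F] have the same law. *)
Lemma realization : exists psi : X -> X, measure_preserving mu psi /\
  exists N, [/\ measurable N, pr N = 0 & forall x, ~ N x -> F (psi x) = L x].
Proof.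
pose X1 := img setT.
have [mX1 pX1] := measurable_img measurableT.
have X10 : pr (~` X1) = 0 by rewrite pr_setC// pX1 pr_setT subrr.
pose psi x := if `[< X1 x >] then G (L x) else x.
have psi1 x : X1 x -> F (psi x) = L x.
  move=> X1x; rewrite /psi asboolT//.
  by case: X1x => _ [y [_ X0y] <-]; rewrite (model_cancel FX X0y).
have psiE A : psi @^-1` A = img A `|` (A `\` X1).
  apply/seteqP; split => x.
    rewrite /= /psi; case: asboolP => [[X0x [y [_ X0y] Fy]]|nX1 Ax].
      rewrite -Fy (model_cancel FX X0y) => Ay; left; split => //.
      by exists y.
    by right.
  case=> [[X0x [y [Ay X0y] Fy]]|[Ax nX1]]; rewrite /= /psi.
    rewrite asboolT -?Fy ?(model_cancel FX X0y)//.
    by split => //; exists y.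
  by rewrite asboolF.
exists psi; split.
  split => [_ A mA|A mA].
    rewrite setTI psiE; apply: measurableU; first exact: (measurable_img mA).1.
    exact: measurableD.
  have [mI pI] := measurable_img mA; have mD := measurableD mA mX1.
  have D0 : pr (A `\` X1) = 0 by apply: (pr_null_le mD (measurableC mX1) _ X10)
    => x [].
  rewrite psiE !prE//; last exact: measurableU.
  congr EFin; rewrite prU// ?pI ?D0 ?addr0//.
  apply/seteqP; split => // x [[X0x [y [Ay X0y] Fy]] [_ nX1]]; apply: nX1.
  by split => //; exists y.
exists (~` X1); split => //; first exact: measurableC.
by move=> x /contrapT; exact: psi1.
Qed.

End realization.

(** * Limits of maps whose coordinates converge geometrically *)

Section cauchy_maps.
Variable u : nat -> X -> X.
Hypotheses (mpu : forall k, measure_preserving mu (u k))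
  (cu : forall k x, `|F (u k.+1 x) - F (u k x)| <= 2 ^- k).

(** The sum of the bounds [2 ^- j] over [j >= k]. *)
Let r k : R := 2 * 2 ^- k.

Let rS k : r k.+1 = r k - 2 ^- k.
Proof. by rewrite /r exprS invfM; field; rewrite expf_neq0. Qed.

Let r0 k : 0 < r k.
Proof. by rewrite mulr_gt0// invr_gt0 exprn_gt0. Qed.

Let r_small e : 0 < e -> exists N, forall k, (N <= k)%N -> r k < e.
Proof.
move=> e0; have : \forall k \near \oo, (1 / 2 : R) ^+ k < e / 2.
  have /cvgrPdist_lt/(_ _ (_ : 0 < e / 2)) : (1 / 2 : R) ^+ k @[k --> \oo] --> 0.
    by apply: cvg_expr; rewrite ger0_norm; lra.
  move=> /(_ ltac:(lra)); apply: filterS => k.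
  by rewrite sub0r normrN; apply: le_lt_trans (ler_norm _).
move=> [N _ h]; exists N => k /h /=; rewrite /r -exprVn.
by rewrite (_ : (1 / 2 : R) = 2^-1) ?div1r//; lra.
Qed.

(** [F (u k x) - r k] increases and [F (u k x) + r k] decreases in [k]; the limit of the former is
    measurable and lies between them. *)
Lemma limit_coordinate : exists2 L : X -> R, measurable_fun setT L &
  forall k x, `|F (u k x) - L x| <= r k.
Proof.
pose a k x := F (u k x) - r k.
pose b k x := F (u k x) + r k.
have a_incr x : {homo a^~ x : n m / (n <= m)%N >-> n <= m}.
  apply/nondecreasing_seqP => n; rewrite /a rS.
  by have := cu n x; rewrite ler_norml => /andP[]; lra.
have b_decr x : {homo b^~ x : n m / (n <= m)%N >-> m <= n}.
  apply/nonincreasing_seqP => n; rewrite /b rS.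
  by have := cu n x; rewrite ler_norml => /andP[]; lra.
have ab x k m : a k x <= b m x.
  apply: (@le_trans _ _ (a (maxn k m) x)); first by apply: a_incr;
    rewrite leq_maxl.
  apply: (@le_trans _ _ (b (maxn k m) x)); last by apply: b_decr;
    rewrite leq_maxr.
  by rewrite /a /b; have := r0 (maxn k m); lra.
have ca x : cvgn (a^~ x).
  apply: nondecreasing_is_cvgn => //; exists (b 0%N x) => _ [k _ <-]; exact: ab.
exists (fun x => limn (a^~ x)).
  apply: (@measurable_fun_cvg _ _ _ _ a) => [k|x _]; last exact: ca.
  apply: measurable_funB => //.
  by apply: measurableT_comp => //; exact: (mpu k).1.
move=> k x; rewrite ler_norml.
have h1 : a k x <= limn (a^~ x) by exact: nondecreasing_cvgn_le.
have h2 : limn (a^~ x) <= b k x by apply: limr_le => //; apply: nearW => m;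
  exact: ab.
by rewrite /a /b in h1 h2; apply/andP; split; lra.
Qed.

Let mFu B k : measurable B -> measurable (u k @^-1` (F @^-1` B)).
Proof.
by move=> mB; apply: (measurable_preimage (mpu k));
  exact: measurable_preimage_fun.
Qed.

(** The two sets differ only where [F (u k x)] is within [r k] of [t], an event of measure at most
    [2 * r k] by [model_itv]. *)
Let conv_ray (L : X -> R) t : measurable_fun setT L ->
  (forall k x, `|F (u k x) - L x| <= r k) ->
  conv_in_measure (fun k => u k @^-1` (F @^-1` `]-oo, t[)) (L @^-1` `]-oo, t[).
Proof.
move=> mL hL e e0; have e30 : 0 < e / 3 by lra.
have [N hN] := r_small e30; exists N => k /hN rk.
have mt : measurable `[t - r k, t + r k] by exact: measurable_itv.
apply: (@le_lt_trans _ _ (pr (u k @^-1` (F @^-1` `[t - r k, t + r k])))).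
  apply: pr_le; last 1 first.
  - rewrite setY_def => x; rewrite /= !in_itv/=.
    have := hL k x; rewrite ler_norml => /andP[h1 h2].
    by move=> [[h3 /negP]|[h3 /negP]]; rewrite -leNgt => h4; apply/andP; split;
      lra.
  - by apply: measurableY; [exact: mFu|exact: measurable_preimage_fun].
  - exact: mFu.
rewrite pr_preimage//; last exact: measurable_preimage_fun.
have le : t - r k <= t + r k by have := r0 k; lra.
have := model_itv FX le; lra.
Qed.

Lemma limit_map : exists psi : X -> X, measure_preserving mu psi /\
  forall A, measurable A ->
    conv_in_measure (fun k => u k @^-1` A) (psi @^-1` A).
Proof.
have [L mL hL] := limit_coordinate.
have cL (B : set R) : measurable B ->
    conv_in_measure (fun k => u k @^-1` (F @^-1` B)) (L @^-1` B).
  move=> mB.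
  (* The Borel sets with the desired convergence form a sigma-algebra containing the open rays. *)
  pose W := [set B : set R | measurable B /\
    conv_in_measure (fun k => u k @^-1` (F @^-1` B)) (L @^-1` B)].
  suff : W B by case.
  have {}mB : (@RGenInftyO.G R).-sigma.-measurable B.
    by rewrite -RGenInftyO.measurableE.
  apply: (mB W); split; last first.
    move=> _ [t ->]; split; first exact: measurable_itv.
    exact: conv_ray.
  split.
  - split => // e e0; exists 0%N => k _.
    by rewrite !preimage_set0 setYK pr_set0.
  - move=> A [mA cA]; rewrite setTD; split; first exact: measurableC.
    exact: (conv_setC cA).
  move=> A hA.
  have mA i : measurable (A i) by case: (hA i).
  have mU : measurable (\bigcup_i A i) by exact: bigcupT_measurable.
  split => // e e0.
  have e40 : 0 < e / 4 by lra.
  pose Am m := \big[setU/set0]_(i < m) A i.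
  have mAm m : measurable (Am m) by exact: bigsetU_measurable.
  have cAm m : conv_in_measure (fun k => u k @^-1` (F @^-1` Am m)) (L @^-1` Am m).
    elim: m => [|m ih].
      rewrite /Am => e' e'0; exists 0%N => k _.
      by rewrite big_ord0 !preimage_set0 setYK pr_set0.
    have -> : Am m.+1 = Am m `|` A m by rewrite /Am big_ord_recr.
    apply: (conv_setU _ _ _ _ ih (hA m).2) => [k|k||].
    - exact: mFu.
    - exact: mFu.
    - exact: measurable_preimage_fun.
    - exact: measurable_preimage_fun.
  (* A countable union is cut to a finite one. As [u k] preserves [mu], the tail for [F] serves all
     [k]; [L] needs its own, since its law is identified only afterwards. *)
  have tail (h : X -> R) : measurable_fun setT h ->
      exists m, forall n, (m <= n)%N -> pr (h @^-1` (\bigcup_i A i `\` Am n)) <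
        e / 4.
    move=> mh.
    have mt n : measurable (h @^-1` (\bigcup_i A i `\` Am n)).
      by apply: measurable_preimage_fun => //; exact: measurableD.
    have dt n : h @^-1` (\bigcup_i A i `\` Am n.+1) `<=` h @^-1` (\bigcup_i A i
      `\` Am n).
      move=> x [Ux nx]; split => // Ax; apply: nx; rewrite /Am big_ord_recr;
        by left.
    have [|m hm] := @pr_nonincreasing _ _ _ mu (fun n =>
      h @^-1` (\bigcup_i A i `\` Am n)) (e / 4) e40 mt dt.
      rewrite (_ : \bigcap_n _ = set0) ?pr_set0//.
      apply/seteqP; split => // x hx.
      have [[i _ Aix] _] := hx 0%N I.
      have [_ []] := hx i.+1 I; rewrite /Am big_ord_recr; by right.
    exists m => n mn; apply: le_lt_trans hm; apply: pr_le => //.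
    move=> x [Ux nx]; split => // Ax; apply: nx.
    by move: x {Ux} Ax => x; rewrite /Am; apply: subset_bigsetU.
  have [m1 h1] := tail _ mF; have [m2 h2] := tail _ mL.
  pose m := maxn m1 m2.
  have [N hN] := cAm m _ e40; exists N => k /hN h3.
  have mT : measurable (\bigcup_i A i `\` Am m) by exact: measurableD.
  have UE : \bigcup_i A i = Am m `|` (\bigcup_i A i `\` Am m).
    rewrite setDUK//; exact: bigsetU_bigcup.
  have mu1 := mFu k mT; have mu2 := measurable_preimage_fun mL mT.
  have mu3 := mFu k (mAm m); have mu4 := measurable_preimage_fun mL (mAm m).
  rewrite [X in L @^-1` X]UE [X in F @^-1` X]UE !preimage_setU.
  apply: le_lt_trans (_ : pr ((u k @^-1` (F @^-1` Am m) `+` L @^-1` Am m) `|`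
     ((u k @^-1` (F @^-1` (\bigcup_i A i `\` Am m))) `|` L @^-1` (\bigcup_i A i
       `\` Am m))) < _).
    apply: pr_le.
    - by apply: measurableY; exact: measurableU.
    - by apply: measurableU; [exact: measurableY|exact: measurableU].
    - apply: subset_trans (@setYU _ _ _ _) _; apply: setUS.
      by rewrite setY_def => x [[? _]|[? _]]; [left|right].
  apply: le_lt_trans (prU_le _ _ _) _; [exact: measurableY|exact: measurableU|].
  have := prU_le mu mu1 mu2.
  rewrite (pr_preimage (mpu k)); last exact: measurable_preimage_fun.
  have := h1 m (leq_maxl _ _); have := h2 m (leq_maxr _ _); lra.
have lawL (B : set R) : measurable B -> pr (L @^-1` B) = pr (F @^-1` B).
  move=> mB; apply/eqP; rewrite -subr_eq0 -normr_le0; apply/ler_addgt0Pl => e e0.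
  rewrite addr0; have [N /(_ N (leqnn N)) h] := cL B mB e e0.
  have mFB := measurable_preimage_fun mF mB.
  rewrite distrC -(pr_preimage (mpu N) mFB); apply: ltW; apply: le_lt_trans h.
  by apply: pr_dist; [exact: mFu|exact: measurable_preimage_fun].
have [psi [mpsi [N [mN N0 hN]]]] := realization mL lawL.
exists psi; split => // A mA e e0.
have [B mB AB] := model_modulo_null mA.
have [M hM] := cL B mB e e0; exists M => k /hM; apply: le_lt_trans.
have mFB := measurable_preimage_fun mF mB.
have mLB := measurable_preimage_fun mL mB.
have muA := measurable_preimage (mpu k) mA.
have muB := mFu k mB.
have mpA := measurable_preimage mpsi mA.
have mpB := measurable_preimage mpsi mFB.
apply: le_trans (prY_triangle mu muA muB mpA) _.
have -> : u k @^-1` A `+` u k @^-1` (F @^-1` B) = u k @^-1` (A `+` F @^-1` B).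
  by rewrite !setY_def.
rewrite (pr_preimage (mpu k)) ?AB ?add0r; last exact: measurableY.
apply: le_trans (prY_triangle mu muB mLB mpA) _.
rewrite -[leRHS]addr0 lerD2l.
apply: le_trans (prY_triangle mu mLB mpB mpA) _.
have -> : psi @^-1` (F @^-1` B) `+` psi @^-1` A = psi @^-1` (F @^-1` B `+` A).
  by rewrite !setY_def.
rewrite (pr_preimage mpsi) 1?(setYC (F @^-1` B)) ?AB ?addr0;
  last exact: measurableY.
rewrite (pr_eq_mod0 mLB mpB mN N0)// => x /hN.
by rewrite /= => ->.
Qed.

End cauchy_maps.

(** Rational rays in the coordinate separate the points of [X0]; there are countably many, so the
    exceptional null sets can be united. *)
Lemma ae_id (h : X -> X) : measure_preserving mu h ->
  (forall A, measurable A -> pr (h @^-1` A `+` A) = 0) ->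
  exists N, [/\ measurable N, pr N = 0 & forall x, ~ N x -> h x = x].
Proof.
move=> mh hA.
pose Q (n : nat) : set X :=
  F @^-1` (if unpickle n is Some q then `]-oo, (ratr (q : rat) : R)[ else set0).
have mQ n : measurable (Q n).
  by apply: measurable_preimage_fun; [exact: mF|case: unpickle].
pose Y n := h @^-1` Q n `+` Q n.
have mY n : measurable (Y n) by apply: measurableY => //;
  exact: (measurable_preimage mh).
have mYoo : measurable (\bigcup_n Y n) by exact: bigcupT_measurable.
have Y0 : pr (\bigcup_n Y n) = 0 by apply: pr_bigcup0 => // n; exact: hA.
have mX0c := measurableC mX0; have mhX := measurable_preimage mh mX0c.
have mXX := measurableU _ _ mX0c mhX.
exists ((~` X0 `|` h @^-1` (~` X0)) `|` \bigcup_n Y n); split.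
- exact: measurableU.
- by do 2 (apply: pr_nullU => //); rewrite (pr_preimage mh).
move=> x /not_orP[/not_orP[/contrapT X0x /contrapT X0hx] nY].
suff Fhx : F (h x) = F x.
  by rewrite -(model_cancel FX X0hx) Fhx (model_cancel FX X0x).
have key q : (F (h x) < ratr q) = (F x < ratr q).
  apply: contrapT => /eqP ne; apply: nY; exists (pickle q) => //.
  rewrite /Y /Q pickleK setY_def /= !in_itv/=.
  by move: ne; case: (F (h x) < _); case: (F x < _) => //= _; [left|right].
apply/eqP; rewrite eq_le; apply/andP; split; rewrite leNgt; apply/negP.
  move=> /rat_in_itvoo[q]; rewrite in_itv/= => /andP[h1 h2].
  by move: h1; rewrite -key => /lt_trans/(_ h2); rewrite ltxx.
move=> /rat_in_itvoo[q]; rewrite in_itv/= => /andP[h1 h2].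
by move: h1; rewrite key => /lt_trans/(_ h2); rewrite ltxx.
Qed.

(** The measure of the part of [A] with coordinate at most [s] is 1-Lipschitz in [s] by [model_itv]
    and runs from 0 to [pr A], so the intermediate value theorem applies. *)
Lemma model_nonatomic : nonatomic mu.
Proof.
move=> A t mA /andP[t0 tA].
pose B (s : R) := A `&` F @^-1` `]-oo, s].
have mB s : measurable (B s).
  by apply: measurableI => //; apply: measurable_preimage_fun => //;
    exact: measurable_itv.
pose h s := pr (B s).
have hlip s s' : s <= s' -> h s <= h s' <= h s + (s' - s).
  move=> ss'; apply/andP; split.
    apply: pr_le => // x [Ax]; rewrite /= !in_itv/= => Fs.
    by split => //; rewrite /= in_itv/= (le_trans Fs).
  have mI : measurable (F @^-1` `[s, s']).
    by apply: measurable_preimage_fun => //; exact: measurable_itv.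
  apply: (@le_trans _ _ (pr (B s `|` F @^-1` `[s, s']))).
    apply: pr_le => //; first exact: measurableU.
    move=> x [Ax]; rewrite /= in_itv/= => Fs'.
    have [Fs|/ltW Fs] := leP (F x) s; [left; split => //|right];
      rewrite /= in_itv/= ?Fs//.
  by apply: le_trans (prU_le _ _ _) _ => //; rewrite lerD2l;
    exact: (model_itv FX).
have hcont : continuous h.
  move=> s; apply/cvgrPdist_lt => e e0; exists e => // s' /= ss'.
  apply: le_lt_trans ss'; have [le|/ltW le] := leP s s'.
    by have /andP[? ?] := hlip _ _ le; rewrite !ler0_norm; lra.
  by have /andP[? ?] := hlip _ _ le; rewrite !ger0_norm; lra.
have h0 : h (-1) = 0.
  rewrite /h (_ : B _ = set0) ?pr_set0//; apply/seteqP; split => // x [_].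
  by rewrite /= in_itv/=; have /andP[] := model_bounds FX x; lra.
have h1 : h 1 = pr A.
  congr (pr _); apply/seteqP; split => [x []//|x Ax]; split => //.
  by rewrite /= in_itv/=; have /andP[] := model_bounds FX x; lra.
have [|||s _ hs] := @IVT R h (-1) 1 t.
- by lra.
- by apply: continuous_subspaceT.
- by rewrite h0 h1 ge_min t0 le_max tA orbT.
by exists (B s); split => // x [].
Qed.

(** * From almost everywhere inverse maps to an automorphism *)

Section everywhere.
Variables (psi chi : X -> X) (N : set X).
Hypotheses (mpsi : measure_preserving mu psi) (mchi : measure_preserving mu chi).
Hypotheses (mN : measurable N) (N0 : pr N = 0).
Hypotheses (psiK : forall x, ~ N x -> chi (psi x) = x)
  (chiK : forall x, ~ N x -> psi (chi x) = x).

Let word (w : seq bool) (x : X) : X :=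
  foldl (fun y b => if b then psi y else chi y) x w.

Let mword w : measure_preserving mu (word w).
Proof.
elim: w => [|b w ih]; first exact: mp_id.
by case: b; [exact: (mp_comp ih mpsi)|exact: (mp_comp ih mchi)].
Qed.

(* The largest set invariant under psi and chi and disjoint from N. *)
Let M := [set x | forall w, ~ N (word w x)].

Let bad (n : nat) : set X :=
  if unpickle n is Some w then word w @^-1` N else set0.

Let MC : ~` M = \bigcup_n bad n.
Proof.
apply/seteqP; split => [x /existsNP[w /contrapT Nw]|x [n _]].
  by exists (pickle w) => //; rewrite /bad pickleK.
by rewrite /bad; case: unpickle => //= w Nw /(_ w).
Qed.

Let mbad n : measurable (bad n).
Proof.
by rewrite /bad; case: unpickle => //= w; exact: (measurable_preimage (mword w)).
Qed.

Let mM : measurable M.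
Proof. by rewrite -(setCK M) MC; apply: measurableC;
  exact: bigcupT_measurable. Qed.

Let M0 : pr (~` M) = 0.
Proof.
rewrite MC; apply: pr_bigcup0 => // n; rewrite /bad; case: unpickle => [w|].
  by rewrite (pr_preimage (mword w)).
exact: pr_set0.
Qed.

Let MN x : M x -> ~ N x. Proof. by move=> /(_ [::]). Qed.

Let Mpsi x : M x -> M (psi x). Proof. by move=> Mx w;
  exact: (Mx (true :: w)). Qed.

Let Mchi x : M x -> M (chi x). Proof. by move=> Mx w;
  exact: (Mx (false :: w)). Qed.

Let on_M (h : X -> X) x := if `[< M x >] then h x else x.

Let on_M_mp h : measure_preserving mu h -> measure_preserving mu (on_M h).
Proof.
move=> mh.
have E A : on_M h @^-1` A = (M `&` h @^-1` A) `|` (A `&` ~` M).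
  apply/seteqP; split => x; rewrite /= /on_M.
    by case: asboolP => Mx; [left|right].
  by case=> [[Mx hx]|[Ax nM]]; [rewrite asboolT|rewrite asboolF].
have mE A : measurable A -> measurable (on_M h @^-1` A).
  move=> mA; rewrite E; apply: measurableU; apply: measurableI => //.
    exact: (measurable_preimage mh).
  exact: measurableC.
split => [_ A mA|A mA]; first by rewrite setTI; exact: mE.
have mhA := measurable_preimage mh mA.
rewrite !prE//; last exact: mE.
congr EFin; rewrite -(pr_preimage mh mA); apply: prY0_eq => //; first exact: mE.
apply: (pr_eq_mod0 (mE _ mA) mhA (measurableC mM) M0) => x /contrapT Mx.
by rewrite /= /on_M asboolT.
Qed.

Let on_M_psiK : cancel (on_M psi) (on_M chi).
Proof.
move=> x; rewrite /on_M; case: (asboolP (M x)) => [Mx|nM];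
  last by rewrite asboolF.
by rewrite asboolT ?psiK//; [exact: MN|exact: Mpsi].
Qed.

Let on_M_chiK : cancel (on_M chi) (on_M psi).
Proof.
move=> x; rewrite /on_M; case: (asboolP (M x)) => [Mx|nM];
  last by rewrite asboolF.
by rewrite asboolT ?chiK//; [exact: MN|exact: Mchi].
Qed.

(** Both maps become the identity off [M]; invariance of [M] makes them inverse everywhere. The
    complement of [M] is a countable union, over words, of null preimages of [N]. *)
Lemma everywhere : exists (s : automorphism mu) (M : set X),
  [/\ measurable M, pr (~` M) = 0 & forall x,
    M x -> s x = psi x /\ aut_inv s x = chi x].
Proof.
exists (Automorphism on_M_psiK on_M_chiK (on_M_mp mpsi) (on_M_mp mchi).1), M.
by split => // x Mx; rewrite /= /on_M asboolT.
Qed.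

End everywhere.

(** For one large [k], [psi] is replaced by [phi k] and then [chi] by its inverse, each at a cost of
    [e / 2]; the composite of the replacements is the identity. *)
Lemma limit_inverse (phi : nat -> automorphism mu) (psi chi : X -> X) :
  measure_preserving mu psi -> measure_preserving mu chi ->
  (forall A, measurable A ->
    conv_in_measure (fun k => phi k @^-1` A) (psi @^-1` A)) ->
  (forall A, measurable A ->
    conv_in_measure (fun k => aut_inv (phi k) @^-1` A) (chi @^-1` A)) ->
  forall A, measurable A -> pr ((chi \o psi) @^-1` A `+` A) = 0.
Proof.
move=> mpsi mchi cpsi cchi A mA; have mcA := measurable_preimage mchi mA.
have mpcA := measurable_preimage mpsi mcA.
apply/eqP; rewrite eq_le pr_ge0 andbT; apply/ler_addgt0Pl => e e0.
have e20 : 0 < e / 2 by lra.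
have [N1 h1] := cpsi _ mcA _ e20; have [N2 h2] := cchi _ mA _ e20.
pose k := maxn N1 N2; have {h1} := h1 k (leq_maxl _ _).
have {h2} := h2 k (leq_maxr _ _).
have mphi := mp_aut (phi k); have mkA := measurable_preimage mphi mcA.
have mi := measurable_preimage (mp_aut_inv (phi k)) mA.
rewrite -(pr_preimage mphi); last exact: measurableY.
rewrite (_ : phi k @^-1` (aut_inv (phi k) @^-1` A `+` chi @^-1` A) =
    A `+` phi k @^-1` (chi @^-1` A)); last first.
  by rewrite !setY_def; apply/seteqP; split => x; rewrite /setD/= autK.
have := prY_triangle mu mpcA mkA mA.
rewrite comp_preimage (setYC A (phi k @^-1` _)).
by rewrite (setYC (phi k @^-1` _) (psi @^-1` _)); lra.
Qed.

(** Convergence of the maps alone yields only a measure preserving limit, so the inverses are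
    required to converge too; images under [phi k] are preimages under its inverse. *)
Lemma limit_automorphism (phi : nat -> automorphism mu) :
  (forall k x, `|F (phi k.+1 x) - F (phi k x)| <= 2 ^- k) ->
  (forall k x, `|F (aut_inv (phi k.+1) x) - F (aut_inv (phi k) x)| <= 2 ^- k) ->
  exists s : automorphism mu, forall A, measurable A ->
    conv_in_measure (fun k => phi k @` A) (s @` A).
Proof.
move=> h h'.
have mphi k := mp_aut (phi k); have mphi' k := mp_aut_inv (phi k).
have [psi [mpsi cpsi]] := limit_map mphi h.
have [chi [mchi cchi]] := limit_map mphi' h'.
have id1 := limit_inverse mpsi mchi cpsi cchi.
have id2 := @limit_inverse (fun k => aut_symm (phi k)) _ _ mchi mpsi cchi cpsi.
have [N1 [mN1 N10 hN1]] := ae_id (mp_comp mchi mpsi) id1.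
have [N2 [mN2 N20 hN2]] := ae_id (mp_comp mpsi mchi) id2.
have [||s [M [mM M0 sM]]] := @everywhere psi chi (N1 `|` N2) mpsi mchi
  (measurableU _ _ mN1 mN2) (pr_nullU mN1 mN2 N10 N20).
- by move=> x /not_orP[/hN1].
- by move=> x /not_orP[_ /hN2].
exists s => A mA e e0; have [K hK] := cchi _ mA _ e0.
exists K => k /hK; apply: le_lt_trans.
have mcA := measurable_preimage mchi mA.
have msA := measurable_image_aut s mA.
have mkA := measurable_image_aut (phi k) mA.
apply: le_trans (prY_triangle mu mkA mcA msA) _.
rewrite -[leRHS]addr0; apply: lerD; first by rewrite image_aut.
rewrite (pr_eq_mod0 mcA msA (measurableC mM) M0)// image_aut => x /contrapT Mx.
by rewrite /= (sM x Mx).2.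
Qed.

End limit_map.

End lebesgue_model.

(** * Conjugation and changes on null sets *)

Section conjugation.
Context d (X : measurableType d) (R : realType) (mu : probability X R).
Local Notation pr := (pr mu).

Lemma aut_compK (phi psi : automorphism mu) :
  cancel (phi \o psi) (aut_inv psi \o aut_inv phi).
Proof. by move=> x; rewrite /= !autK. Qed.

Lemma aut_comp_invK (phi psi : automorphism mu) :
  cancel (aut_inv psi \o aut_inv phi) (phi \o psi).
Proof. by move=> x; rewrite /= !aut_invK. Qed.

Definition aut_comp (phi psi : automorphism mu) : automorphism mu :=
  Automorphism (@aut_compK phi psi) (@aut_comp_invK phi psi)
    (mp_comp (mp_aut phi) (mp_aut psi))
    (mp_comp (mp_aut_inv psi) (mp_aut_inv phi)).1.

Definition aut_conj (S phi : automorphism mu) : automorphism mu :=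
  aut_comp (aut_symm phi) (aut_comp S phi).

Lemma image_aut_comp (phi psi : automorphism mu) (A : set X) :
  aut_comp phi psi @` A = phi @` (psi @` A).
Proof. by rewrite !image_aut. Qed.

Lemma iter_conjugate (T : X -> X) (phi : automorphism mu) i x :
  iter i (conjugate T phi) x = aut_inv phi (iter i T (phi x)).
Proof.
elim: i => [|i ih]; first by rewrite /= autK.
by rewrite iterS ih /conjugate /= aut_invK.
Qed.

Lemma mixing_mean_conjugate (T : X -> X) (phi : automorphism mu) (A B : set X) n :
  measure_preserving mu T -> measurable A -> measurable B ->
  mixing_mean mu (conjugate T phi) A B n =
  mixing_mean mu T (phi @` A) (phi @` B) n.
Proof.
move=> mpT mA mB; rewrite !mixing_meanE; congr (_ * _).
apply: eq_bigr => i _; rewrite /pr !measure_image_aut//.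
congr `| _ - _|; rewrite -/(pr _) -/(pr _).
rewrite -(pr_preimage (mp_aut phi) (A := phi @` A `&` _)); last first.
  apply: measurableI; first exact: measurable_image_aut.
  by apply: (measurable_preimage (mp_iter i mpT)); exact: measurable_image_aut.
congr (pr _); rewrite !image_aut; apply/seteqP; split => x /=.
  by rewrite iter_conjugate autK.
by rewrite iter_conjugate autK.
Qed.

Lemma iter_ae_eq (T : X -> X) (S : automorphism mu) i :
  {ae mu, forall x, T x = S x} -> {ae mu, forall x, iter i T x = iter i S x}.
Proof.
move=> [N [mN N0 TS]]; elim: i => [|i [M [mM M0 ih]]]; first exact: aeW.
have mpi := mp_iter i (mp_aut S).
exists (M `|` iter i S @^-1` N); split.
- by apply: measurableU => //; exact: (measurable_preimage mpi).
- apply/negligibleP; last apply: negligibleU.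
  + by apply: measurableU => //; exact: (measurable_preimage mpi).
  + by exists M; split.
  + exists (iter i S @^-1` N); split => //;
      first exact: (measurable_preimage mpi).
    by rewrite [LHS](mpi.2 _ mN).
- move=> x /= nTS; apply: contrapT => /not_orP[nM nN]; apply: nTS.
  have -> : iter i T x = iter i S x by apply: contrapT => /ih.
  by apply: contrapT => /TS.
Qed.

Lemma mixing_mean_ae_eq (T : X -> X) (S : automorphism mu) (A B : set X) n :
  measure_preserving mu T -> {ae mu, forall x, T x = S x} ->
  measurable A -> measurable B -> mixing_mean mu T A B n = mixing_mean mu S A B n.
Proof.
move=> mpT TS mA mB; rewrite !mixing_meanE; congr (_ * _).
apply: eq_bigr => i _; congr `| _ - _|.
have [N [mN N0 hN]] := iter_ae_eq i TS.
have m1 := measurable_preimage (mp_iter i mpT) mB.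
have m2 := measurable_preimage (mp_iter i (mp_aut S)) mB.
apply: prY0_eq; try exact: measurableI.
apply: (pr_eq_mod0 _ _ mN) => [|||x nN]; try exact: measurableI.
  by rewrite /pr N0.
have e : iter i T x = iter i S x by apply: contrapT => /hN.
by rewrite /= e.
Qed.

Lemma weak_mixing_conj (S phi : automorphism mu) :
  weak_mixing mu S -> weak_mixing mu (aut_conj S phi).
Proof.
move=> wm A B mA mB.
have -> : (fun n => mixing_mean mu (aut_conj S phi) A B n) =
          (fun n => mixing_mean mu S (phi @` A) (phi @` B) n).
  apply/funext => n; rewrite -(mixing_mean_conjugate phi n (mp_aut S))//.
by apply: wm; exact: measurable_image_aut.
Qed.

Lemma image_ae_eq (phi psi : automorphism mu) (A : set X) : measurable A ->
  {ae mu, forall x, phi x = psi x} -> pr ((phi @` A) `+` (psi @` A)) = 0.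
Proof.
move=> mA [N [mN N0 hN]].
have mpA := measurable_image_aut phi mA; have mqA := measurable_image_aut psi mA.
have mpN := measurable_image_aut phi mN; have mqN := measurable_image_aut psi mN.
have prN0 : pr N = 0 by rewrite /pr N0.
apply: (pr_eq_mod0 mpA mqA (measurableU _ _ mpN mqN)).
  by apply: pr_nullU => //; rewrite /pr measure_image_aut// N0.
move=> x /not_orP[np nq]; split=> [[a Aa ax]|[a Aa ax]]; exists a => //;
  rewrite -ax.
  apply: contrapT => ne; apply: np; exists a => //; apply: hN => e.
  by apply: ne; rewrite e.
apply: contrapT => ne; apply: nq; exists a => //; apply: hN => e.
by apply: ne; rewrite e.
Qed.

End conjugation.

(** * Genericity *)

Section residual.
Context d (X : measurableType d) (R : realType) (mu : probability X R).
Local Notation pr := (pr mu).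
Variables (F : X -> R) (X0 : set X) (G : R -> X).
Hypothesis FX : lebesgue_model mu F X0 G.
Variables (S : automorphism mu) (wm : weak_mixing mu S).
Variables (C : set (set X)) (mC : C `<=` measurable) (del : R).
Hypotheses (del0 : 0 < del)
  (Cdel : forall (I : finType) (kap : X -> I), mcoloring kap ->
     exists2 A, C A & del <= color_dist mu kap A).
Implicit Types phi psi : automorphism mu.

(** Membership is given by some representative; [mixing_failsP] passes to any other. The strict
    inequality yields openness, and [N <= n] lets the intersection control the upper limit. *)
Definition mixing_fails (N : nat) : set (Phi mu) :=
  [set q | exists psi, q = aut_class psi /\ exists n A, [/\ (N <= n)%N, C A &
    del ^+ 2 / 2 < mixing_mean mu S (psi @` A) (psi @` A) n]].

Lemma mixing_failsP N psi : mixing_fails N (aut_class psi) ->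
  exists n A, [/\ (N <= n)%N, C A &
    del ^+ 2 / 2 < mixing_mean mu S (psi @` A) (psi @` A) n].
Proof.
move=> [phi [/aut_classP e [n [A [Nn CA h]]]]]; exists n, A; split => //.
apply: lt_le_trans h _.
have mA := mC CA; have mp := measurable_image_aut phi mA.
have mq := measurable_image_aut psi mA.
apply: le_trans (mixing_mean_lip n (mp_aut S) mp mq mp mq) _.
by rewrite setYC (image_ae_eq mA e); lra.
Qed.

(** One witness [n], [A] persists nearby: the mean varies by at most four times the symmetric
    difference of the images of [A], hence a quarter of the excess as radius. *)
Lemma open_mixing_fails N : open (mixing_fails N).
Proof.
move=> phi /mixing_failsP[n [A [Nn CA h]]]; have mA := mC CA.
exists [set A], ((mixing_mean mu S (phi @` A) (phi @` A) n - del ^+ 2 / 2) / 4).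
split; [exact: finite_set1|by move=> _ ->|by lra|].
move=> psi /(_ A erefl); have mp := measurable_image_aut phi mA.
have mq := measurable_image_aut psi mA.
rewrite prE ?lte_fin; last exact: measurableY.
move=> hA; exists psi; split => //; exists n, A; split => //.
have := mixing_mean_lip n (mp_aut S) mp mq mp mq.
by rewrite (setYC (phi @` A)); lra.
Qed.

Definition dyadic_sets (k : nat) : seq (set R) :=
  [seq [set t | t < j%:R / 2 ^+ k] | j <- iota 0 (2 ^ k).+1].

(** For [s <= t], take the least [j] with [s < j / 2 ^ k]: then both points lie between
    [(j - 1) / 2 ^ k] and [j / 2 ^ k]. *)
Lemma dyadic_close k s t : 0 <= s < 1 -> 0 <= t < 1 ->
  (forall D, D \in dyadic_sets k -> (D s <-> D t)) -> `|s - t| <= 2 ^- k.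
Proof.
wlog st : s t / s <= t.
  move=> h hs ht hD; have [st|ts] := orP (le_total s t); first exact: h.
  by rewrite distrC; apply: (h _ _ ts ht hs) => D Dk; have [? ?] := hD D Dk;
    split.
move=> /andP[s0 s1] /andP[t0 t1] hD.
have k0 : (0 : R) < 2 ^+ k by rewrite exprn_gt0.
have ex : exists j : nat, s < j%:R / 2 ^+ k.
  by exists (2 ^ k)%N; rewrite natrX divff ?lt0r_neq0.
have [j sj jmin] := ex_minnP ex.
have jk : (j <= 2 ^ k)%N by apply: jmin; rewrite natrX divff ?lt0r_neq0.
have tj : t < j%:R / 2 ^+ k.
  apply: (hD [set t | t < j%:R / 2 ^+ k] _).1 => //.
  by apply/mapP; exists j => //; rewrite mem_iota add0n ltnS jk.
case: j sj jmin jk tj => [|j] sj jmin jk tj.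
  by move: sj; rewrite mul0r ltNge s0.
have js : j%:R / 2 ^+ k <= s.
  by rewrite leNgt; apply/negP => /jmin; rewrite ltnn.
rewrite ler0_norm; last by lra.
by move: tj; rewrite -[j.+1]addn1 natrD mulrDl mul1r; lra.
Qed.

Lemma measurable_dyadic k D : D \in dyadic_sets k -> measurable D.
Proof.
move=> /mapP[j _ ->]; rewrite (_ : [set _ | _] = `]-oo, j%:R / 2 ^+ k[%classic).
  exact: measurable_itv.
by apply/seteqP; split => x; rewrite /= in_itv.
Qed.

(** [destroy_mixing] is applied to the conjugate of [S] by [phi], with points colored by their
    membership in the sets of [l]. *)
Lemma destroy_mixing_list (phi : automorphism mu) (l : seq (set X)) N :
  (forall Q, Q \in l -> measurable Q) ->
  exists s : automorphism mu, (forall Q x, Q \in l -> (Q (s x) <-> Q x)) /\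
    exists n A, [/\ (N <= n)%N, C A & del ^+ 2 / 2 <
      mixing_mean mu S (aut_comp phi s @` A) (aut_comp phi s @` A) n].
Proof.
move=> ml; pose kap := color_by (fun=> tt) (nth set0 l) (size l).
have mk : mcoloring kap.
  apply: mcoloring_color_by => [|k]; first exact: mcoloring_unit.
  have [kl|lk] := ltnP k (size l); first by apply: ml; exact: mem_nth.
  by rewrite nth_default.
have [A CA hA] := Cdel mk; have mA := mC CA.
have [s [sk [n Nn hn]]] := destroy_mixing (weak_mixing_conj phi wm)
  (model_nonatomic FX) N mk mA del0 hA.
exists s; split.
  move=> Q x Ql; have /color_by_eq/(_ (index Q l)) := sk x.
  by rewrite index_mem nth_index//; apply.
exists n, A; split => //; rewrite image_aut_comp.
have msA := measurable_image_aut s mA.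
by rewrite -(mixing_mean_conjugate phi n (mp_aut S) msA msA).
Qed.

Definition refine_step (k : nat) (p p' : automorphism mu * seq (set X)) :=
  exists s : automorphism mu, exists n A,
  [/\ p'.1 = aut_comp p.1 s /\ p'.2 = A :: p.2,
      forall Q x, Q \in p.2 -> (Q (s x) <-> Q x),
      forall D x, D \in dyadic_sets k -> (D (F (s x)) <-> D (F x)),
      forall D x, D \in dyadic_sets k -> (D (F (p.1 (s x))) <-> D (F (p.1 x))) &
      [/\ (k <= n)%N, C A & del ^+ 2 / 2 < mixing_mean mu S (p'.1 @` A) (p'.1
        @` A) n]].

Lemma refine_step_ex k p : (forall Q, Q \in p.2 -> measurable Q) ->
  exists p', refine_step k p p'.
Proof.
move=> mp.
have mF := model_measurable_fun FX.
pose l := p.2 ++ [seq F @^-1` D | D <- dyadic_sets k] ++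
  [seq p.1 @^-1` (F @^-1` D) | D <- dyadic_sets k].
have ml Q : Q \in l -> measurable Q.
  rewrite !mem_cat => /or3P[/mp//|/mapP[D Dk ->]|/mapP[D Dk ->]];
    have mD := measurable_dyadic Dk;
      have mFD := measurable_preimage_fun mF mD => //.
  exact: (measurable_preimage (mp_aut p.1)).
have [s [sl [n [A [kn CA h]]]]] := destroy_mixing_list p.1 k ml.
exists (aut_comp p.1 s, A :: p.2), s, n, A; split => //.
- by move=> Q x Qp; apply: sl; rewrite !mem_cat Qp.
- move=> D x Dk; apply: (sl (F @^-1` D)); rewrite !mem_cat.
  by apply/or3P/Or32; apply/mapP; exists D.
- move=> D x Dk; apply: (sl (p.1 @^-1` (F @^-1` D))); rewrite !mem_cat.
  by apply/or3P/Or33; apply/mapP; exists D.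
Qed.

(** The set chosen at stage [N] is frozen afterwards, so the limit has the same image of it up to a
    null set and inherits its large mixing mean; one limit thus serves all [N]. *)
Lemma dense_mixing_fails (phi0 : automorphism mu) (l0 : seq (set X)) :
  (forall Q, Q \in l0 -> measurable Q) ->
  exists s : automorphism mu,
    (forall Q, Q \in l0 -> pr ((s @` Q) `+` (phi0 @` Q)) = 0) /\
    forall N, mixing_fails N (aut_class s).
Proof.
move=> ml0.
have /choice[next nextP] (kp : nat * (automorphism mu * seq (set X))) :
    exists p', (forall Q, Q \in kp.2.2 -> measurable Q) -> refine_step kp.1
      kp.2 p'.
  have [mp|nmp] := pselect (forall Q, Q \in kp.2.2 -> measurable Q).
    by have [p' hp'] := refine_step_ex kp.1 mp; exists p'.
  by exists kp.2 => /nmp.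
pose fix st k := if k is m.+1 then next (m, st m) else (phi0, l0).
have mst k : forall Q, Q \in (st k).2 -> measurable Q.
  elim: k => // k ih Q /=; have [s [n [A [[_ ->] _ _ _ [_ CA _]]]]] :=
    nextP (k, st k) ih.
  by rewrite in_cons => /predU1P[->|/ih]//; exact: mC.
have step k : refine_step k (st k) (st k.+1) by exact: (nextP (k, st k) (mst k)).
pose phi k := (st k).1.
have close k x : `|F (phi k.+1 x) - F (phi k x)| <= 2 ^- k.
  have [s [n [A [[e _] _ _ h _]]]] := step k.
  apply: dyadic_close; try exact: (model_bounds FX).
  by move=> D Dk; rewrite /phi e; exact: h.
have close' k x : `|F (aut_inv (phi k.+1) x) - F (aut_inv (phi k) x)| <= 2 ^- k.
  have [s [n [A [[e _] _ h _ _]]]] := step k.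
  apply: dyadic_close; try exact: (model_bounds FX).
  move=> D Dk; rewrite /phi e /=; have := h D (aut_inv s (aut_inv (phi k) x)) Dk.
  by rewrite aut_invK => H; split => /H.
have [s hs] := limit_automorphism FX close close'.
have stable k Q : Q \in (st k).2 -> pr ((s @` Q) `+` (phi k @` Q)) = 0.
  move=> Qk; have mQ := mst k _ Qk.
  (* Later factors act first and preserve [Q], so its image no longer changes. *)
  have const m : Q \in (st (m + k)%N).2 /\ phi (m + k)%N @` Q = phi k @` Q.
    elim: m => [|m [Qm em]]; first by rewrite add0n.
    have [t [n [A [[e e'] h _ _ _]]]] := step (m + k)%N.
    rewrite addSn e' in_cons Qm orbT; split => //.
    rewrite /phi e image_aut_comp -em; congr (_ @` _).
    rewrite image_aut; apply/seteqP; split => x /=.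
      by move=> /(h Q _ Qm); rewrite aut_invK.
    by move=> Qx; apply/(h Q _ Qm); rewrite aut_invK.
  apply/eqP; rewrite eq_le pr_ge0 andbT; apply/ler_addgt0Pl => e e0;
    rewrite addr0.
  have [N hN] := hs _ mQ _ e0.
  have := hN (N + k)%N (leq_addr _ _); rewrite (const N).2 setYC; exact: ltW.
exists s; split; first by move=> Q Ql; exact: (stable 0%N).
move=> N; exists s; split => //.
have [t [n [A [[_ e'] _ _ _ [Nn CA h]]]]] := step N; have mA := mC CA.
exists n, A; split => //; apply: lt_le_trans h _.
have mp := measurable_image_aut (phi N.+1) mA;
  have mq := measurable_image_aut s mA.
apply: le_trans (mixing_mean_lip n (mp_aut S) mp mq mp mq) _.
by rewrite setYC stable ?e' ?mem_head//; lra.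
Qed.

Lemma residual_mixing_fails :
  dense (\bigcap_N mixing_fails N) /\ Gdelta (\bigcap_N mixing_fails N).
Proof.
split; last by exists mixing_fails => // i; exact: open_mixing_fails.
move=> O [q Oq] oO.
have [phi0 qE] : exists phi0, q = aut_class phi0.
  by exists (repr q); rewrite /aut_class reprK.
rewrite {}qE in Oq; have [L [e [/finite_seqP[l lE] mL e0 hL]]] := oO phi0 Oq.
have [|s [sl hs]] := @dense_mixing_fails phi0 l.
  by move=> Q Ql; apply: mL; rewrite lE.
exists (aut_class s); split; last by move=> N _.
apply: hL => A LA; have mA := mL _ LA.
have mY : measurable ((s @` A) `+` (phi0 @` A)).
  by apply: measurableY; exact: measurable_image_aut.
by rewrite (prE mu mY) sl ?lte_fin//; move: LA; rewrite lE.
Qed.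

End residual.

(** * Coordinate models of Lebesgue spaces *)

Section lebesgue_space_model.
Context d (X : measurableType d) (R : realType) (mu : probability X R).
Local Notation pr := (pr mu).

(** This treats the Borel and the completed case together: [Y] is the real line with either
    sigma-algebra, and the sandwich hypothesis compares its measurable sets with Borel sets. *)
Lemma isomorphic_mod0_model d' (Y : measurableType d')
    (nu : {measure set Y -> \bar R}) (r : Y -> R) (r' : R -> Y) :
  cancel r r' -> cancel r' r -> measurable_fun setT r ->
  (forall B : set R, measurable B -> nu (r @^-1` B) = lebesgue_measure B) ->
  (forall S, measurable S -> exists B N : set R,
    [/\ measurable B /\ measurable N, B `<=` r @` S, r @` S `<=` B `|` N,
      lebesgue_measure N = 0%E & N = set0 \/ measure_is_complete nu]) ->
  isomorphic_mod0 mu nu (r @^-1` `[0, 1[) ->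
  exists F X0 G, lebesgue_model mu F X0 G.
Proof.
move=> rK r'K mr nur sand [X0 [Y0 [f [g [[mX0 X00] [mY0 Y0E _] [ff gg fK gK]
  [mf mg] mufg]]]]].
have fY x : X0 x -> Y0 (f x) by move=> X0x; exact: ff.
have gX y : Y0 y -> X0 (g y) by move=> Y0y; exact: gg.
have fgK x : X0 x -> g (f x) = x by move=> /mem_set; exact: fK.
have gfK y : Y0 y -> f (g y) = y by move=> /mem_set; exact: gK.
have mfS S : measurable S -> measurable (X0 `&` f @^-1` S) by exact: mf.
have mgS S : measurable S -> measurable (Y0 `&` g @^-1` S) by exact: mg.
have mrB (B : set R) : measurable B -> measurable (r @^-1` B).
  by move=> mB; rewrite -[_ @^-1` _]setTI; exact: mr.
(* The value 0 off [X0] keeps the coordinate in [[0, 1)]. *)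
pose F x := if `[< X0 x >] then r (f x) else 0.
have FX x : X0 x -> F x = r (f x) by move=> X0x; rewrite /F asboolT.
have pX0 : pr (~` X0) = 0 by rewrite /pr X00.
have mF : measurable_fun setT F.
  move=> _ B mB; rewrite setTI.
  have -> : F @^-1` B = (X0 `&` f @^-1` (r @^-1` B)) `|` (~` X0 `&` (fun=> 0)
    @^-1` B).
    apply/seteqP; split => x; rewrite /= /F.
      by case: asboolP; [left|right].
    by case=> [[? ?]|[? ?]]; [rewrite asboolT|rewrite asboolF].
  apply: measurableU; first exact: mfS (mrB _ mB).
  apply: measurableI; first exact: measurableC.
  by rewrite preimage_cst; case: ifP.
have muF (B : set R) : measurable B ->
    (mu (F @^-1` B) <= lebesgue_measure B)%E.
  move=> mB; have mFB := measurable_preimage_fun mF mB.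
  have mYB := measurableI _ _ mY0 (mrB _ mB).
  have -> : mu (F @^-1` B) = mu (X0 `&` f @^-1` (Y0 `&` r @^-1` B)).
    rewrite !prE//; last exact: mfS.
    congr EFin; apply: prY0_eq => //; first exact: mfS.
    apply: (pr_eq_mod0 mFB (mfS _ mYB) (measurableC mX0) pX0) => x /contrapT X0x.
    rewrite /= FX//; split => [?|[_ []]//]; split => //; split => //; exact: fY.
  rewrite mufg// -nur//; apply: le_measure; rewrite ?inE//; first exact: mrB.
exists F, X0, (g \o r'); split => //.
- move=> x; rewrite /F; case: asboolP => [/fY/Y0E|_]; last by rewrite lexx ltr01.
  by rewrite /= in_itv.
- by move=> x X0x; rewrite /= FX// rK fgK.
- move=> a b ab; have mab : measurable (`[a,
    b]%classic : set R) by exact: measurable_itv.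
  have := muF _ mab; rewrite lebesgue_measure_itv/= prE;
    last exact: measurable_preimage_fun.
  case: ifPn; first by rewrite lte_fin -EFinB lee_fin.
  by rewrite lee_fin => _ /le_trans; apply; rewrite subr_ge0.
move=> A mA; have [B [N [[mB mN] BS SB N0 cN]]] := sand _ (mgS _ mA).
have imE : F @` (A `&` X0) = r @` (Y0 `&` g @^-1` A).
  apply/seteqP; split => [_ [x [Ax X0x] <-]|_ [y [Y0y gA] <-]].
    rewrite FX//; exists (f x) => //; split; first exact: fY.
    by rewrite /= fgK.
  by exists (g y); [split => //; exact: gX|rewrite FX ?gfK//; exact: gX].
exists B, N; rewrite imE; split => //.
  apply/eqP; rewrite eq_le pr_ge0 andbT -lee_fin -prE;
    last exact: measurable_preimage_fun.
  by apply: le_trans (muF _ mN) _; rewrite N0.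
case: cN => [?|cN]; [by left|right].
(* Completeness is transported: [M] pulls back along [g] into a null set of [nu], where it is
   measurable, and returns along [f]. *)
move=> Z M mZ Z0 MZ.
have mYZ := mgS _ mZ.
have nuZ : nu (Y0 `&` g @^-1` Z) = 0%E.
  rewrite -mufg// (_ : X0 `&` _ = X0 `&` Z).
    have mXZ := measurableI _ _ mX0 mZ.
    by rewrite [LHS](prE mu mXZ) (pr_null_le mXZ mZ _ Z0).
  apply/seteqP; split => x [X0x] /=; first by rewrite fgK// => -[].
  by move=> Zx; split => //; split; [exact: fY|rewrite /= fgK].
have mfM : measurable (Y0 `&` g @^-1` M).
  apply: cN; exists (Y0 `&` g @^-1` Z); split => //.
  by move=> y [Y0y /MZ[]].
rewrite (_ : M = X0 `&` f @^-1` (Y0 `&` g @^-1` M)); first exact: mfS.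
apply/seteqP; split => x.
  move=> Mx; have [_ X0x] := MZ _ Mx; split => //; split; first exact: fY.
  by rewrite /= fgK.
by move=> [X0x [_ /=]]; rewrite fgK.
Qed.

Lemma lebesgue_space_model : lebesgue_space mu ->
  exists F X0 G, lebesgue_model mu F X0 G.
Proof.
case=> iso.
- apply: (@isomorphic_mod0_model _ _ (@lebesgue_measure R) idfun idfun _ _ _ _
    _ iso) => //.
    exact: measurable_id.
  move=> S mS; exists S, set0; split => //; last by left.
  + by rewrite image_id.
  + by rewrite image_id setU0.
- apply: (@isomorphic_mod0_model _ _ (@completed_lebesgue_measure R) idfun
    idfun _ _ _ _ _ iso) => //.
  + move=> _ B mB; rewrite setTI; exact: sub_caratheodory.
  + move=> S mS.
    have : (completed_algebra_gen (@lebesgue_measure R)).-sigma.-measurable S.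
      by rewrite completed_caratheodory_measurable.
    (* A set of the completed sigma-algebra is a Borel set [B] together with a subset of a Borel
       null set [N]. *)
    rewrite g_sigma_completed_algebra_genE => -[B mB [M [N [mN N0 MN]] <-]].
    exists B, N; rewrite image_id; split => //.
    * by apply: setUS.
    * by right; exact: completed_lebesgue_measure_is_complete.
Qed.

End lebesgue_space_model.

Theorem corollary2 (d : measure_display) (X : measurableType d) (R : realType)
    (mu : probability X R) (T : X -> X) (C : set (set X))
    (mpT : measure_preserving mu T) (wmT : weak_mixing mu T)
    (mC : C `<=` measurable) :
  (family_entropy mu C = 0%E -> uniformly_weak_mixing_on mu T C) /\
  (invertible mu T -> lebesgue_space mu -> (0 < family_entropy mu C)%E ->
    exists G : set (Phi mu),
      [/\ dense G, Gdelta G &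
        forall phi : automorphism mu, G (aut_class phi) ->
          (0 < limn_esup (sup_self_mixing_mean mu (conjugate T phi) C))%E]).
Proof.
split; first exact: uniformly_weak_mixing_entropy0.
move=> [S TS] /lebesgue_space_model[F [X0 [G FX]]] /(family_entropy_gt0 mC)[del
  del0 hdel].
(* Mixing means ignore null sets, so the residual set is built for the everywhere invertible [S] and
   its bound transferred back to [T]. *)
have wmS : weak_mixing mu S.
  move=> A B mA mB; have := wmT _ _ mA mB.
  by under eq_fun do rewrite (mixing_mean_ae_eq _ mpT TS mA mB).
have [dG GG] := residual_mixing_fails FX wmS mC del0 hdel.
exists (\bigcap_N mixing_fails S C del N); split => // phi Gphi.
apply: (@lt_le_trans _ _ (del ^+ 2 / 2)%:E).
  by rewrite lte_fin divr_gt0// exprn_gt0.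
apply: limn_esup_ge => N.
have [n [A [Nn CA h]]] := mixing_failsP mC (Gphi N I).
exists n => //; have mA := mC _ CA; have mpA := measurable_image_aut phi mA.
apply: le_trans (_ : (mixing_mean mu (conjugate T phi) A A n)%:E <= _)%E.
  rewrite lee_fin mixing_mean_conjugate//.
  by rewrite (mixing_mean_ae_eq _ mpT TS mpA mpA) ltW.
by apply: ereal_sup_ubound; exists A.
Qed.
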